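(* Let $Q$ be a countable better quasi-order. If $Q$ is thin, then the class $\mathcal{T}_Q$ of $Q$-labeled trees of height at most $\omega$, ordered by $\leqq_1$, is thin.
   Context: A quasi-order is a set (or class) $Q$ with a reflexive transitive relation $\leqq_Q$. $[\omega]^\omega$ is the set of infinite subsets of $\omega$, identified with strictly increasing sequences and topologized as a subspace of $\omega^\omega$; for infinite $A\subseteq\omega$, $[A]^\omega$ is the set of infinite subsets of $A$. A quasi-order $Q$ is a better quasi-order (BQO) if, giving $Q$ the discrete topology, for every Borel map $f:[\omega]^\omega\to Q$ there is $A\in[\omega]^\omega$ such that $f(B)\leqq_Q f(B\setminus\{\min B\})$ for all $B\in[A]^\omega$. A Borel graph is a pair $(V,E)$ with $V$ Polish and $E\subseteq[V]^2$ Borel. Its Borel chromatic number $\chi_B$ is the least cardinality $|Y|$ of a Polish space $Y$ for which there is a Borel map $V\to Y$ sending adjacent vertices to distinct points. For a countable BQO $Q$, let $\vec Q=\{X\in Q^\omega:\forall k\in\omega,\ X(k)\not\leqq_Q X(k+1)\}$ (subspace of $Q^\omega$ with the product of discrete topologies), regarded as a Borel graph in which distinct $X,Y$ are adjacent iff $S(X)=Y$ or $S(Y)=X$, where $S(X)(k)=X(k+1)$. A countable BQO $Q$ is thin if $\chi_B(\vec Q)\leq 3$. A BQO (set or class) that is not assumed countable is called thin if every countably infinite subset of it, with the induced order, is thin. A tree is a partial order $(T,\leq_T)$ such that for each $t\in T$ the set $\{v\in T:v\leq_T t\}$ is well ordered by $\leq_T$, and $T$ has a $\leq_T$-least element (the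 root). $\mathcal{T}_Q$ is the class of pairs $(T,l)$ with $T$ a tree of height $\leq\omega$ and $l:T\to Q$. The order $\leqq_1$: $(T_1,l_1)\leqq_1(T_2,l_2)$ iff there is $f:T_1\to T_2$ such that for all $x,y\in T_1$, $x<_{T_1}y$ implies $f(x)<_{T_2}f(y)$, and $l_1(x)\leqq_Q l_2(f(x))$ for all $x\in T_1$. *)

(* Defs.v *)
From Stdlib Require Import Relation_Definitions Rdefinitions.
From HB Require Import structures.
From mathcomp Require Import all_boot all_order all_algebra.
From mathcomp Require Import all_classical all_reals all_analysis.
From mathcomp Require Import Rstruct.

Set Implicit Arguments.
Unset Strict Implicit.
Unset Printing Implicit Defensive.

Import Order.TTheory GRing.Theory Num.Theory.

Local Open Scope classical_set_scope.
Local Open Scope ring_scope.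

Definition borel_map (X Y : topologicalType) (f : X -> Y) : Prop :=
  forall B : set Y, <<s @open Y >> B -> <<s @open X >> (f @^-1` B).

Definition is_metric (T : Type) (d : T -> T -> Rdefinitions.R) : Prop :=
  [/\ forall x y, 0 <= d x y,
      forall x y, d x y = 0 <-> x = y,
      forall x y, d x y = d y x
    & forall x y z, d x z <= d x y + d y z].

Definition metrizes (T : topologicalType)
    (d : T -> T -> Rdefinitions.R) : Prop :=
  forall U : set T, open U <->
    forall x, U x ->
      exists2 e : Rdefinitions.R, 0 < e & [set y | d x y < e] `<=` U.

Definition complete_metric (T : Type) (d : T -> T -> Rdefinitions.R) : Prop :=
  forall u : nat -> T,
    (forall e : Rdefinitions.R, 0 < e ->
      exists N, forall m n, (N <= m)%N -> (N <= n)%N -> d (u m) (u n) < e) ->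
    exists x, forall e : Rdefinitions.R, 0 < e ->
      exists N, forall n, (N <= n)%N -> d (u n) x < e.

(* The empty space counts as Polish. *)
Definition polish (T : topologicalType) : Prop :=
  (exists2 D : set T, countable D & dense D) /\
  (exists d : T -> T -> Rdefinitions.R,
    [/\ is_metric d, metrizes d & complete_metric d]).

Definition borel_coloring (V : topologicalType) (E : V -> V -> Prop)
    (Y : topologicalType) (c : V -> Y) : Prop :=
  borel_map c /\ forall x y, E x y -> c x <> c y.

Definition borel_colorable (V : topologicalType) (E : V -> V -> Prop)
    (Y : topologicalType) : Prop :=
  polish Y /\ exists c : V -> Y, borel_coloring E c.

(* chi_B(V, E) is the cardinality of Y. *)
Definition is_borel_chromatic (V : topologicalType) (E : V -> V -> Prop)
    (Y : topologicalType) : Prop :=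
  borel_colorable E Y /\
  forall Z : topologicalType, borel_colorable E Z -> ([set: Y] #<= [set: Z])%card.

Definition borel_chromatic_le (V : topologicalType) (E : V -> V -> Prop)
    (n : nat) : Prop :=
  exists2 Y : topologicalType, is_borel_chromatic E Y & ([set: Y] #<= `I_n)%card.

Definition shift (T : Type) (X : nat -> T) : nat -> T := fun k => X k.+1.

(* [omega]^omega, with an infinite set identified with its increasing
   enumeration; used as a type, it carries the topology induced from the product
   topology on nat -> nat, with nat discrete. *)
Definition infsubsets : set {ptws nat -> nat} :=
  [set B | forall k, (B k < B k.+1)%N].

(* [A]^omega *)
Definition infsubsets_of (A : infsubsets) : set infsubsets :=
  [set B : infsubsets | range (val B) `<=` range (val A)].

Lemma shift_infsubsets (B : infsubsets) :
  (shift (val B) : {ptws nat -> nat}) \in infsubsets.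
Proof. by rewrite inE => k; have := set_valP B; apply. Qed.

(* B \ {min B}: see range_tail. *)
Definition tail (B : infsubsets) : infsubsets :=
  exist _ (shift (val B) : {ptws nat -> nat}) (shift_infsubsets B).

Lemma range_tail (B : infsubsets) :
  (forall k, (val B 0 <= val B k)%N) /\
  range (val (tail B)) = range (val B) `\ val B 0.
Proof.
have BS := set_valP B; rewrite /infsubsets /= in BS.
have B0 k : (val B 0 < val B k.+1)%N.
  by elim: k => [|k IH]; [exact: BS|exact: ltn_trans IH (BS _)].
split=> [[|k]//|]; first exact/ltnW.
apply/seteqP; split=> [_ [k _ <-]|x [[[|k] _ <-]]] //=.
- split; first by exists k.+1.
  by move=> /esym kE; have := B0 k; rewrite /= /shift in kE *; rewrite kE ltnn.
- by move=> _; exists k.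
Qed.

(* The product Q^omega of copies of the discrete space Q. *)
Notation baire Q := {ptws nat -> discrete_topology {classic Q}}.

Definition bqo (Q : Type) (leQ : Q -> Q -> Prop) : Prop :=
  Relation_Definitions.preorder Q leQ /\
  forall f : infsubsets -> discrete_topology {classic Q}, borel_map f ->
    exists A : infsubsets, forall B, infsubsets_of A B -> leQ (f B) (f (tail B)).

(* The vertex set of the graph vec Q; used as a type, it has the topology
   induced from Q^omega. *)
Definition vec (Q : Type) (leQ : Q -> Q -> Prop) : set (baire Q) :=
  [set X | forall k, ~ leQ (X k) (X k.+1)].

Definition vec_adj (Q : Type) (leQ : Q -> Q -> Prop) (X Y : vec leQ) : Prop :=
  X <> Y /\ (shift (val X) = val Y \/ shift (val Y) = val X).

(* Thinness of a countable better quasi-order. *)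
Definition countable_thin (Q : Type) (leQ : Q -> Q -> Prop) : Prop :=
  borel_chromatic_le (@vec_adj Q leQ) 3.

(* Thinness of a better quasi-order that is not assumed countable. *)
Definition thin (Q : Type) (leQ : Q -> Q -> Prop) : Prop :=
  bqo leQ /\
  forall A : set Q, (A #= [set: nat])%card ->
    countable_thin (fun x y : A => leQ (val x) (val y)).

Definition well_ordered_on (T : Type) (leT : T -> T -> Prop) (D : set T) : Prop :=
  forall A : set T, A `<=` D -> A !=set0 ->
    exists2 m, A m & forall x, A x -> leT m x.

Definition is_tree (T : Type) (leT : T -> T -> Prop) : Prop :=
  [/\ Relation_Definitions.order T leT,
      forall t, well_ordered_on leT [set v | leT v t]
    & exists r, forall t, leT r t].

(* The height of t is the order type of its set of strict predecessors; the tree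
   has height at most omega iff every node has height < omega. *)
Definition height_le_omega (T : Type) (leT : T -> T -> Prop) : Prop :=
  forall t, finite_set [set v | leT v t /\ v <> t].

(* The class T_Q; carriers range over a universe. *)
Record labeled_tree (Q : Type) := LabeledTree {
  node : Type;
  node_le : node -> node -> Prop;
  node_label : node -> Q;
  node_tree : is_tree node_le;
  node_height : height_le_omega node_le
}.

Definition node_lt (Q : Type) (T : labeled_tree Q) (x y : node T) : Prop :=
  node_le x y /\ x <> y.

Definition ltree_le1 (Q : Type) (leQ : Q -> Q -> Prop)
    (T1 T2 : labeled_tree Q) : Prop :=
  exists f : node T1 -> node T2,
    (forall x y, node_lt x y -> node_lt (f x) (f y)) /\
    (forall x, leQ (node_label x) (node_label (f x))).

(* Main.v *)
Require Import Defs.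
From mathcomp Require Import all_boot all_classical.
From mathcomp Require Import all_order all_algebra all_analysis Rstruct zify.

(** Trees are compared by a game. The first player climbs T1; the second player
answers each node by a node of T2 with a larger label, climbing strictly from
one answer to the next. If T1 is not below T2, then the first player has a
winning strategy ([wins_root]), and a strategy can be taken to be a well-founded
tree, so that no play against it goes on forever.

Let X be a sequence of trees in which no X k is below X k.+1. Fix winning
strategies for all pairs (X k, X k.+1) and play all the games at once, the nodes
that the strategy of game k.+1 visits in X k.+1 being offered as answers in game
k. An offer that is not a legal answer is passed over, and game k waits for
the next one. Every game makes finitely many moves; let z k be the label of the
last node visited in X k. The heart of the proof ([run_limits_bad]) is that
z k is not below z k.+1 for infinitely many k. Indeed, if z k is below z k.+1,
the last node of X k.+1 is not a legal answer any more, which means that game k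
had already consumed it: the last move of game k.+1 came strictly before the
last move of game k. This cannot happen for all large k.

The sequence z commutes with the shift, and z k is a pointwise limit of functions
that depend on finitely many terms of X ([limit_reduction]). Both halves of the
theorem follow from this alone.

Thinness ([countable_thin_transfer]): it suffices to find a Borel set that each
orbit of the shift meets and leaves infinitely often ([three_colouring]). If
z k is below z k.+1 infinitely often, the set of those X for which z 0 is not
below z 1 does this. Otherwise a tail of z is a vertex of the graph of Q, and a
colouring of that graph in 0, 1, 2 goes up infinitely often and down infinitely
often along z, because neighbouring colours differ.

Better quasi-order ([bqo_transfer]): let f be a Borel map from infinite sets to
trees. On the infinite subsets of some set it is locally constant
([borel_locally_constant]). By the Galvin-Prikry theorem, after a further
shrinking f B is below f (tail B) always or never. In the second case the
sequences f B, f (tail B), ... are bad, and mapping B to z 0 contradicts that Q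
is a better quasi-order.

Local constancy needs an argument of its own since the trees form an uncountable
discrete space. The Galvin-Prikry theorem makes f, composed with an injection of
its range into Baire space, continuous on the subsets of some A. If the range on
these is countable, a second application concludes. If it is uncountable, a
Cantor scheme yields a continuous copy of the space of infinite sets on which f
is injective; then all sets of infinite sets would be Borel, hence Ramsey, which
the axiom of choice refutes ([exists_non_ramsey]). *)

Set Implicit Arguments.
Unset Strict Implicit.
Unset Printing Implicit Defensive.

Local Open Scope classical_set_scope.

(** * Sequence spaces over discrete spaces *)
Definition agree (T : Type) (n : nat) (B C : nat -> T) : Prop :=
  forall i, (i < n)%N -> B i = C i.

Definition slide (T : Type) (k : nat) (X : nat -> T) : nat -> T :=
  fun i => X (k + i)%N.

Section Prefix.
Context {T : topologicalType} (discT : forall A : set T, open A).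

(** The prefix filter converges in each coordinate, hence in the product. *)
Lemma nbhs_prefix (B : {ptws nat -> T}) (A : set {ptws nat -> T}) :
  nbhs B A -> exists n, forall C : nat -> T, agree n B C -> A C.
Proof.
pose F : set_system {ptws nat -> T} :=
  [set A | exists n, forall C : nat -> T, agree n B C -> A C].
have FF : Filter F.
  split; first by exists 0%N.
  - move=> A1 A2 [n1 h1] [n2 h2]; exists (maxn n1 n2) => C BC.
    by split; [apply: h1|apply: h2] => i ilt; apply: BC; rewrite leq_max ilt ?orbT.
  - by move=> A1 A2 A12 [n h]; exists n => C /h /A12.
suff : F --> B by move=> h /h.
apply/cvg_sup => i A' /= [U [[V oV <-] UB] UA].
exists i.+1 => C BC; apply: UA; rewrite /= /proj.
by rewrite -(BC i).
Qed.

Lemma open_cylinder (B : {ptws nat -> T}) (n : nat) :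
  open [set C : {ptws nat -> T} | agree n B C].
Proof.
elim: n => [|n IH].
  suff -> : [set C : {ptws nat -> T} | agree 0 B C] = setT by exact: openT.
  by apply/seteqP; split.
have -> : [set C : {ptws nat -> T} | agree n.+1 B C] =
   [set C | agree n B C] `&` (@proj _ _ n @^-1` [set B n]).
  apply/seteqP; split=> C /=.
    by move=> BC; split=> [i ilt|]; [apply: BC; exact: ltnW|rewrite /proj BC].
  by move=> [BC Cn] i; rewrite ltnS leq_eqVlt => /orP[/eqP ->|/BC//].
apply: openI => //; apply: open_comp; last exact: discT.
by move=> *; exact: proj_continuous.
Qed.

(** This replaces the product and subspace topologies by a condition on finite
prefixes in all later continuity arguments. *)
Lemma open_prefixP (V : set {ptws nat -> T}) (U : set V) :
  open U <-> forall B : V, U B ->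
    exists n, forall C : V, agree n (val B) (val C) -> U C.
Proof.
split=> [[A oA <-] B /= AB|h].
  have [n hn] := nbhs_prefix (open_nbhs_nbhs (conj oA AB)).
  by exists n => C /hn.
pose W n (B : V) := forall C : V, agree n (val B) (val C) -> U C.
exists (\bigcup_(p in [set p : nat * V | W p.1 p.2])
  [set C : {ptws nat -> T} | agree p.1 (val p.2 : nat -> T) C]).
  by apply: bigcup_open => -[n B] _; exact: open_cylinder.
apply/seteqP; split=> [C [[n B] /= hW BC]|C UC]; first exact: hW.
by have [n hn] := h _ UC; exists (n, C).
Qed.
End Prefix.

(** * The Galvin-Prikry theorem *)
Definition unbounded (A : set nat) : Prop := forall n, exists2 m, (n <= m)%N & A m.

Lemma unboundedT : unbounded setT.
Proof. by move=> n; exists n. Qed.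

Definition above (t : seq nat) (A : set nat) : set nat :=
  [set m | A m /\ all (fun x => x < m)%N t].

Lemma unbounded_above t A : unbounded A -> unbounded (above t A).
Proof.
move=> iA n; have [m nm Am] := iA (maxn n (\max_(x <- t) x).+1).
exists m; first exact: leq_trans (leq_maxl _ _) nm.
split=> //; apply/allP => x xt; apply: leq_trans (leq_trans (leq_maxr _ _) nm).
by rewrite ltnS; exact: leq_bigmax_seq.
Qed.

(** Diagonalization: shrink to decide P for the finitely many t below the next
element, pick that element, and repeat. The set of picked elements works for
every t at once, because all that it contains above t was picked after t had
been decided. *)
Lemma diagonal_reservoir (P : seq nat -> set nat -> Prop) (A : set nat) :
  unbounded A ->
  (forall t A1 A2, P t A1 -> A2 `<=` A1 -> P t A2) ->
  (forall t A1, A1 `<=` A -> unbounded A1 ->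
    exists A2, [/\ A2 `<=` A1, unbounded A2 & P t A2]) ->
  exists A', [/\ A' `<=` A, unbounded A' &
    forall t, sorted ltn t -> {in t, forall x, A' x} -> P t (above t A')].
Proof.
move=> iA hered dense.
have dense_seq (L : seq (seq nat)) A0 : A0 `<=` A -> unbounded A0 ->
    exists A', [/\ A' `<=` A0, unbounded A' & {in L, forall t, P t A'}].
  elim: L A0 => [|t L IH] A0 A0A iA0; first by exists A0; split=> // t; rewrite in_nil.
  have [A1 [A10 iA1 PA1]] := IH _ A0A iA0.
  have [A2 [A21 iA2 PA2]] := dense t _ (subset_trans A10 A0A) iA1.
  exists A2; split=> //; first exact: (subset_trans A21).
  by move=> u; rewrite inE => /orP[/eqP ->//|uL]; exact: hered (PA1 _ uL) A21.
pose L a := [seq mask (tval m) (iota 0 a.+1) | m <- enum {: (a.+1).-tuple bool}].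
(* [L a] lists all subsets of {0, ..., a}. *)
have memL a t : sorted ltn t -> {in t, forall x, (x <= a)%N} -> t \in L a.
  move=> st ta.
  have : subseq t (iota 0 a.+1).
    apply/subseq_uniqP; first exact: iota_uniq.
    apply: (irr_sorted_eq ltn_trans ltnn) => //.
      by apply: sorted_filter; [exact: ltn_trans|exact: iota_ltn_sorted].
    move=> x; rewrite mem_filter mem_iota /= add0n ltnS.
    by case xt: (x \in t) => //=; rewrite ta.
  case/subseqP => m; rewrite size_iota => sm ->.
  by apply/mapP; exists (@Tuple _ _ m (introT eqP sm)) => //; rewrite mem_enum.
pose R := {A' | A' `<=` A /\ unbounded A'}.
have step (A1 : R) : exists p : nat * R,
    [/\ sval A1 p.1, sval p.2 `<=` [set m | sval A1 m /\ (p.1 < m)%N] &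
        {in L p.1, forall t, P t (sval p.2)}].
  case: A1 => A1 [A1A iA1]; have [a _ A1a] := iA1 0%N.
  have A1'A : above [:: a] A1 `<=` A by move=> m [/A1A].
  have [A2 [A21 iA2 PA2]] := dense_seq (L a) _ A1'A (@unbounded_above [:: a] _ iA1).
  exists (a, exist _ A2 (conj (subset_trans A21 A1'A) iA2)); split=> //= m /A21 [Am /=].
  by rewrite andbT.
have [next nextP] := choice step.
have [A0 [A0A iA0 PA0]] := dense [::] _ (@subset_refl _ A) iA.
pose S n := iter n (fun A => (next A).2) (exist _ A0 (conj A0A iA0)).
pose a n := (next (S n)).1.
have Ssub n k : sval (S (n + k)%N) `<=` sval (S n).
  elim: k => [|k IH]; first by rewrite addn0.
  rewrite addnS /= => m; have [_ + _] := nextP (S (n + k)%N).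
  by move=> /[apply] -[/IH].
have aS n k : (n <= k)%N -> sval (S n) (a k).
  by move=> /subnKC nk; apply: (Ssub n (k - n)%N); rewrite nk; case: (nextP (S k)).
have a_lt n k : (n < k)%N -> (a n < a k)%N.
  by move=> /(aS n.+1) /=; case: (nextP (S n)) => _ sub _ /sub [].
have a_ge n : (n <= a n)%N.
  by elim: n => // n IH; apply: leq_ltn_trans IH (a_lt _ _ _).
exists (range a); split.
- by move=> _ [n _ <-]; apply: (A0A); exact: (aS 0%N).
- by move=> n; exists (a n) => //; exists n.
move=> t; case/lastP: t => [_ _|t x st tA'].
  by apply: hered PA0 _ => _ [[n _ <-] _]; exact: (aS 0%N).
have [n _ nx] : range a x by apply: tA'; rewrite mem_rcons mem_head.
have [_ _ /(_ (rcons t x)) PS] := nextP (S n).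
apply: hered (PS _) _.
  rewrite -/(a n) nx; apply: memL => // y.
  rewrite mem_rcons inE => /orP[/eqP ->//|yt]; apply: ltnW.
  move: st; rewrite -cats1 (sorted_pairwise ltn_trans) pairwise_cat.
  by case/andP=> /allrelP /(_ y x yt) + _; apply; rewrite inE.
move=> _ [[k _ <-]]; rewrite all_rcons -{1}nx => /andP[+ _].
have [/aS //|kn] := ltnP n k.
move: kn; rewrite leq_eqVlt => /orP[/eqP ->|/a_lt]; rewrite ?ltnn //.
by move=> /ltn_trans h /h; rewrite ltnn.
Qed.

Lemma infsubsets_lt (B : infsubsets) i j : (i < j)%N -> (val B i < val B j)%N.
Proof.
have BS := set_valP B; rewrite /infsubsets /= in BS.
elim: j => // j IH; rewrite ltnS leq_eqVlt => /orP[/eqP ->|/IH h].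
  exact: BS.
exact: ltn_trans h (BS _).
Qed.

(** The basic Ellentuck open set [t, A]. No order between t and A is imposed:
as members are increasing, only the part of A above t can occur in them. *)
Definition box (t : seq nat) (A : set nat) : set infsubsets :=
  [set B | agree (size t) (val B) (nth 0%N t) /\
    forall i, (size t <= i)%N -> A (val B i)].

Definition decided (U : set infsubsets) (t : seq nat) (A : set nat) : Prop :=
  box t A `<=` U \/ box t A `<=` ~` U.

(** The sets completely Ramsey in the Ellentuck topology. The quantification
over t is what makes the property pass to countable unions. *)
Definition completely_ramsey (U : set infsubsets) : Prop :=
  forall t A, unbounded A ->
    exists A', [/\ A' `<=` A, unbounded A' & decided U t A'].

Lemma box_sub t A A' : A' `<=` A -> box t A' `<=` box t A.
Proof. by move=> AA B [tB BA]; split=> // i /BA /AA. Qed.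

Lemma decided_sub U t A A' : decided U t A -> A' `<=` A -> decided U t A'.
Proof. by move=> [h|h] /box_sub AA; [left|right] => B /AA /h. Qed.

Lemma box_above t u A : box (t ++ u) A `<=` box (t ++ u) (above u A).
Proof.
move=> B [tB BA]; split=> // i si; split; first exact: BA.
apply/(all_nthP 0%N) => j ju.
have jt : (size t + j < size (t ++ u))%N by rewrite size_cat ltn_add2l.
have := tB _ jt; rewrite nth_cat -ltn_subRL subnn ltn0 addKn => <-.
by apply: infsubsets_lt; exact: leq_trans si.
Qed.

Lemma box_cat t A B n : box t A B ->
  exists u, [/\ size u = n, sorted ltn u, {in u, forall x, A x} &
    forall A', (forall i, (size t + n <= i)%N -> A' (val B i)) -> box (t ++ u) A' B].
Proof.
move=> [tB BA]; exists (mkseq (fun i => val B (size t + i)%N) n); split.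
- by rewrite size_mkseq.
- apply/(sortedP 0%N) => i; rewrite size_mkseq => ilt.
  by rewrite !nth_mkseq ?(ltnW ilt) //; apply: infsubsets_lt; rewrite addnS.
- by move=> _ /mapP[i _ ->]; apply: BA; exact: leq_addr.
move=> A' BA'; split; last by rewrite size_cat size_mkseq.
move=> i; rewrite size_cat size_mkseq nth_cat => ilt.
have [/tB //|ti] := ltnP i (size t).
by rewrite nth_mkseq ?subnKC // ltn_subLR.
Qed.

Definition prefix_open (U : set infsubsets) : Prop :=
  forall B, U B -> exists n, forall C : infsubsets, agree n (val B) (val C) -> U C.

(** The accept-reject argument of Nash-Williams: in a reservoir that decides all
its finite subsets, a rejected set has only rejected extensions after another
diagonalization, whereas an element of the open set has an accepted prefix. *)
Lemma ramsey_open (U : set infsubsets) : prefix_open U -> completely_ramsey U.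
Proof.
move=> oU t A iA.
pose rejects u A := forall A', A' `<=` A -> unbounded A' -> ~ box (t ++ u) A' `<=` U.
pose P u A := box (t ++ u) A `<=` U \/ rejects u A.
have rejects_sub u (A1 A2 : set nat) : rejects u A1 -> A2 `<=` A1 -> rejects u A2.
  by move=> r A21 A' A'2; apply: r; exact: subset_trans A21.
have [||A1 [A1A iA1 PA1]] := @diagonal_reservoir P _ iA.
- move=> u A1 A2 [h|h] A21; [left|right].
    by apply: subset_trans h; exact: box_sub.
  exact: rejects_sub A21.
- move=> u A1 A1A iA1.
  have [[A2 [A21 iA2 h]]|/forallNP h] := pselect
    (exists A2, [/\ A2 `<=` A1, unbounded A2 & box (t ++ u) A2 `<=` U]).
    by exists A2; split=> //; left.
  by exists A1; split=> //; right=> A2 A21 iA2 b; apply: (h A2); split.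
(* The elements of a reservoir that lie below max u occur in no member of the
   box, so both alternatives pass from [above u A1] back to A1. *)
have {}PA1 u : sorted ltn u -> {in u, forall x, A1 x} ->
    box (t ++ u) A1 `<=` U \/ rejects u A1.
  move=> su uA1; have [h|r] := PA1 u su uA1; [left|right].
    exact: subset_trans (@box_above _ _ _) h.
  move=> A' A'1 iA' b; apply: (r (above u A')).
  - by move=> m [/A'1 ? ?]; split.
  - exact: unbounded_above.
  - by apply: subset_trans b; apply: box_sub => m [].
have [tU|rej0] : box t A1 `<=` U \/ rejects [::] A1.
    by have := PA1 [::] isT; rewrite cats0; apply=> x; rewrite in_nil.
  by exists A1; split=> //; left.
pose P' u A := sorted ltn u -> {in u, forall x, A1 x} -> rejects u A1 ->
  forall a, A a -> all (fun x => x < a)%N u -> rejects (rcons u a) A1.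
have sorted_rcons u (a : nat) : sorted ltn u -> all (fun x => x < a)%N u ->
    sorted ltn (rcons u a).
  move=> su ua; rewrite -cats1 (sorted_pairwise ltn_trans) pairwise_cat /=.
  rewrite -(sorted_pairwise ltn_trans) su !andbT; apply/allrelP => x y xu.
  by rewrite inE => /eqP ->; exact: (allP ua).
have [||A2 [A21 iA2 PA2]] := @diagonal_reservoir P' _ iA1.
- by move=> u A2 A3 h A32 su uA1 r a /A32; exact: h.
- move=> u A2 A21 iA2.
  have [[su uA1 r]|nr] := pselect [/\ sorted ltn u, {in u, forall x, A1 x} & rejects u A1];
    last by exists A2; split=> // su uA1 r; case: nr.
  pose bad := [set a | [/\ A2 a, all (fun x => x < a)%N u & ~ rejects (rcons u a) A1]].
  (* If infinitely many one-point extensions of u were accepted, they would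
     form a reservoir that accepts u. *)
  have [ibad|] := pselect (unbounded bad).
    case: (r bad) => //; first by move=> a [/A21].
    move=> B [tB Bbad]; set n := size (t ++ u) in tB Bbad.
    have [A2a ua nra] : bad (val B n) by exact: Bbad.
    have uaA1 : {in rcons u (val B n), forall x, A1 x}.
      by move=> x; rewrite mem_rcons inE => /orP[/eqP ->|/uA1 //]; exact: A21.
    have [h|//] := PA1 _ (sorted_rcons _ _ su ua) uaA1.
    apply: h; split=> [i|i]; rewrite -rcons_cat size_rcons.
      rewrite nth_rcons ltnS leq_eqVlt => /orP[/eqP ->|ilt]; first by rewrite ltnn eqxx.
      by rewrite ilt; exact: tB.
    by move=> ni; have [/A21] := Bbad i (ltnW ni).
  move=> /existsNP[n nbad]; exists (A2 `&` [set a | (n <= a)%N]); split.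
  - by move=> a [].
  - move=> m; have [a ma A2a] := iA2 (maxn m n); move: ma; rewrite geq_max => /andP[ma na].
    by exists a.
  - move=> _ _ _ a [A2a na] ua; apply: contrapT => nr; apply: nbad.
    by exists a.
have {PA2 sorted_rcons} rej u : sorted ltn u -> {in u, forall x, A2 x} -> rejects u A1.
  elim/last_ind: u => // u a IH su uA2.
  have [su' ua] : sorted ltn u /\ all (fun x => x < a)%N u.
    move: su; rewrite -cats1 (sorted_pairwise ltn_trans) pairwise_cat.
    rewrite -(sorted_pairwise ltn_trans) => /and3P[/allrelP h -> _]; split=> //.
    by apply/allP => x xu; apply: h => //; rewrite inE.
  have uA2' : {in u, forall x, A2 x} by move=> x xu; apply: uA2; rewrite mem_rcons inE xu orbT.
  have A2a : A2 a by apply: uA2; rewrite mem_rcons mem_head.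
  by apply: (PA2 u) => //; [move=> x /uA2' /A21|exact: IH].
exists A2; split=> //; first exact: subset_trans A1A.
right=> B tB UB; have [n hn] := oU B UB.
have [u [su sortu uA2 uB]] := box_cat n tB.
apply: (rej u sortu uA2 A2 A21 iA2) => C [uC _]; apply: hn.
have [uB' _] := uB setT (fun _ _ => I).
move=> i ilt; rewrite uB' ?uC // size_cat su; exact: leq_trans ilt (leq_addl _ _).
Qed.

(** The diagonal set decides the i-th set on all prefixes of length i, which
makes all the sets V i relatively clopen simultaneously, with a modulus that
does not depend on the point. *)
Lemma ramsey_fusion (V : nat -> set infsubsets) t A :
  (forall i, completely_ramsey (V i)) -> unbounded A ->
  exists A', [/\ A' `<=` A, unbounded A' &
    forall i B C, box t A' B -> box t A' C ->
      agree (size t + i) (val B) (val C) -> V i B -> V i C].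
Proof.
move=> rV iA.
pose P u A := forall i, (i <= size u)%N -> decided (V i) (t ++ u) A.
have [||A1 [A1A iA1 PA1]] := @diagonal_reservoir P _ iA.
- by move=> u A1 A2 PA1 A21 i iu; exact: decided_sub (PA1 i iu) A21.
- move=> u A1 _ iA1.
  suff [A2 [A21 iA2 dA2]] : exists A2, [/\ A2 `<=` A1, unbounded A2 &
      forall i, (i < (size u).+1)%N -> decided (V i) (t ++ u) A2].
    by exists A2.
  elim: (size u).+1 => [|n [A2 [A21 iA2 dA2]]]; first by exists A1; split.
  have [A3 [A32 iA3 dA3]] := rV n (t ++ u) _ iA2.
  exists A3; split=> //; first exact: subset_trans A21.
  move=> i; rewrite ltnS leq_eqVlt => /orP[/eqP -> //|/dA2 d].
  exact: decided_sub d A32.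
exists A1; split=> // i B C tB tC BC ViB.
have [u [su sortu uA1 uB]] := box_cat i tB.
have [uBa BA] := box_above (uB A1 (fun j h => tB.2 j (leq_trans (leq_addr _ _) h))).
have uC : box (t ++ u) A1 C.
  split=> j; rewrite size_cat su => hj.
    by rewrite -BC // uBa // size_cat su.
  by apply: tC.2; exact: leq_trans (leq_addr _ _) hj.
have [|h|h] := PA1 u sortu uA1 i; first by rewrite su.
  exact: h (box_above uC).
by case: (h _ (conj uBa BA)).
Qed.

(** After fusion the union is relatively open, which reduces to the open case. *)
Lemma ramsey_bigcup (V : nat -> set infsubsets) :
  (forall i, completely_ramsey (V i)) -> completely_ramsey (\bigcup_i V i).
Proof.
move=> rV t A iA; have [A1 [A1A iA1 hA1]] := ramsey_fusion t rV iA.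
pose O : set infsubsets := [set B | exists n, forall C : infsubsets,
   box t A1 C -> agree n (val B) (val C) -> (\bigcup_i V i) C].
have oO : prefix_open O.
  move=> B [n hn]; exists n => C BC; exists n => D tD CD; apply: hn => // i ilt.
  by rewrite BC // CD.
have [A2 [A21 iA2 dA2]] := ramsey_open oO t iA1.
exists A2; split=> //; first exact: subset_trans A1A.
case: dA2 => h; [left|right] => B tB; have tB1 := box_sub A21 tB.
  by have [n] := h _ tB; apply.
move=> [i _ ViB]; apply: (h _ tB); exists (size t + i)%N => C tC BC.
by exists i => //; exact: hA1 BC ViB.
Qed.

(** The Galvin-Prikry theorem. *)
Lemma ramsey_borel (U : set infsubsets) : <<s @open infsubsets >> U -> completely_ramsey U.
Proof.
apply: smallest_sub; last first.
  move=> V oV; apply: ramsey_open.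
  by apply/(@open_prefixP nat) => // A; exact: discrete_open.
split.
- by move=> t A iA; exists A; split=> //; right=> B _.
- move=> V rV t A /(rV t)[A' [A'A iA' d]]; exists A'; split=> //.
  by case: d => h; [right|left] => B /h // ? [].
- exact: ramsey_bigcup.
Qed.

(** * Borel sets, and a set that is not Ramsey *)
Notation borel U := (<<s open >> U).

Section BorelSets.
Context {V : topologicalType}.
Implicit Types U : set V.

Lemma borel_open U : open U -> borel U.
Proof. exact: sub_sigma_algebra. Qed.

Lemma borelC U : borel U -> borel (~` U).
Proof. by rewrite -setTD; exact: sigma_algebraCD. Qed.

Lemma borel_bigcup (F : nat -> set V) :
  (forall n, borel (F n)) -> borel (\bigcup_n F n).
Proof. exact: sigma_algebra_bigcup. Qed.

Lemma borel_bigcap (F : nat -> set V) :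
  (forall n, borel (F n)) -> borel (\bigcap_n F n).
Proof.
move=> bF; rewrite -[X in borel X]setCK setC_bigcap.
by apply: borelC; apply: borel_bigcup => n; exact: borelC.
Qed.

Lemma borelI U U' : borel U -> borel U' -> borel (U `&` U').
Proof.
move=> bU bU'; have -> : U `&` U' = \bigcap_n (if n is 0 then U else U').
  apply/seteqP; split=> [x [Ux U'x] [|n] _ //|x h].
  by split; [exact: (h 0%N)|exact: (h 1%N)].
by apply: borel_bigcap => -[].
Qed.

Lemma borelU U U' : borel U -> borel U' -> borel (U `|` U').
Proof.
move=> bU bU'; rewrite -[X in borel X]setCK setCU.
by apply: borelC; apply: borelI; exact: borelC.
Qed.

Lemma borel_cst (P : Prop) : borel [set _ : V | P].
Proof.
have [p|np] := pselect P.
  have -> : [set _ : V | P] = setT by apply/seteqP; split.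
  by apply: borel_open; exact: openT.
have -> : [set _ : V | P] = set0 by apply/seteqP; split.
by apply: borel_open; exact: open0.
Qed.

End BorelSets.

Lemma borel_preimage (V W : topologicalType) (g : V -> W) :
  (forall O, open O -> borel (g @^-1` O)) -> borel_map g.
Proof.
move=> oW B; move: B; apply: smallest_sub => //; split.
- by rewrite /= preimage_set0; apply: borel_open; exact: open0.
- by move=> A; rewrite /= setTD preimage_setC; exact: borelC.
- by move=> F bF; rewrite /= preimage_bigcup; exact: borel_bigcup.
Qed.

Lemma open_infsubsetsP (U : set infsubsets) : open U <-> prefix_open U.
Proof. by apply: (@open_prefixP nat) => A; exact: discrete_open. Qed.

Lemma infsubset_exists (b : nat -> nat) :
  (forall k, (b k < b k.+1)%N) -> exists B : infsubsets, val B = b.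
Proof.
move=> bS; have bP : (b : {ptws nat -> nat}) \in infsubsets by rewrite inE.
by exists (exist _ (b : {ptws nat -> nat}) bP).
Qed.

Lemma infsubset_of_unbounded A : unbounded A -> exists B : infsubsets, box [::] A B.
Proof.
move=> iA; have /choice [next nextP] : forall n, exists m, (n <= m)%N /\ A m.
  by move=> n; have [m] := iA n; exists m.
pose b n := iter n (fun m => next m.+1) (next 0%N).
have [|B Bb] := @infsubset_exists b; first by move=> k; have [] := nextP (b k).+1.
exists B; rewrite /box /= Bb; split=> // -[|n] _ /=.
  by have [] := nextP 0%N.
by have [] := nextP (b n).+1.
Qed.

Lemma infsubset_range_inj (B C : infsubsets) :
  range (val B) = range (val C) -> B = C.
Proof.
move=> BC; apply/val_inj/funext => i; elim/ltn_ind: i => i IH.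
have half (B' C' : infsubsets) : range (val B') = range (val C') ->
    (forall j, (j < i)%N -> val B' j = val C' j) -> ~ (val B' i < val C' i)%N.
  move=> BC' agr lt; have [j _ Cj] : range (val C') (val B' i) by rewrite -BC'; exists i.
  have ji : (j < i)%N.
    rewrite ltnNge; apply/negP; rewrite leq_eqVlt => /orP[/eqP ij|/(infsubsets_lt C')].
      by move: lt; rewrite -Cj ij ltnn.
    by rewrite Cj => /(ltn_trans lt); rewrite ltnn.
  by have := infsubsets_lt B' ji; rewrite agr // Cj ltnn.
apply/eqP; rewrite eqn_leq; apply/andP; split; rewrite leqNgt; apply/negP.
  by apply: half => // j /IH.
exact: half.
Qed.

(** Choose a representative in each class of sets with a common tail. The parity
of the number of steps to meet the representative changes from B to [tail B],
while a homogeneous set contains both. *)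
Lemma exists_non_ramsey : exists G : set infsubsets, ~ completely_ramsey G.
Proof.
pose meet (B C : infsubsets) m n := forall i, val B (m + i)%N = val C (n + i)%N.
have meet_parity B C m n m' n' : meet B C m n -> meet B C m' n' ->
    odd (m + n) = odd (m' + n').
  move=> h h'; have e : (n + m' = n' + m)%N.
    have C_eq : val C (n + m')%N = val C (n' + m)%N by rewrite -h -h' addnC.
    have [/(infsubsets_lt C)|/(infsubsets_lt C)|//] := ltngtP (n + m') (n' + m).
      by rewrite C_eq ltnn.
    by rewrite C_eq ltnn.
  have : odd ((m + n) + (m' + n')) = false.
    by rewrite (addnC m n) addnACA (addnC m n') e addnn odd_double.
  by rewrite oddD; case: odd; case: odd.
pose cls (B : infsubsets) : set infsubsets := [set C | exists m n, meet B C m n].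
have [B0 _] := @infsubset_of_unbounded setT unboundedT.
have /choice [rep repP] : forall S : set infsubsets, exists C, S !=set0 -> S C.
  move=> S; by have [[C SC]|nS] := pselect (S !=set0); [exists C|exists B0].
have cls_tail B : cls (tail B) = cls B.
  apply/seteqP; split=> C [m [n h]].
    by exists m.+1, n => i; rewrite addSn; exact: h.
  by exists m, n.+1 => i; rewrite addSnnS -h addnS.
pose G : set infsubsets :=
  [set B | exists m n, meet B (rep (cls B)) m n /\ odd (m + n)].
have GP B : G (tail B) <-> ~ G B.
  have [m [n h]] : cls B (rep (cls B)).
    by apply: repP; exists B, 0%N, 0%N.
  have h' : meet (tail B) (rep (cls B)) m n.+1.
    by move=> i; rewrite addSnnS -h addnS.
  rewrite /G /= cls_tail; split.
    move=> [m' [n' [/(meet_parity _ _ _ _ _ _ h') <-]]]; rewrite addnS /= => odd1.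
    by move=> [m2 [n2 [/(meet_parity _ _ _ _ _ _ h) <-]]]; apply/negP.
  move=> nG; exists m, n.+1; split=> //; rewrite addnS /=; apply/negP => o.
  by apply: nG; exists m, n.
exists G => rG.
have [A [_ iA d]] := rG [::] setT unboundedT.
have [B tB] := infsubset_of_unbounded iA.
have tB' : box [::] A (tail B) by split=> // i _; exact: (tB.2 i.+1).
by case: d => d; have := d _ tB; have := d _ tB'; rewrite /= GP.
Qed.

(** * Borel maps into discrete spaces *)
Definition locally_constant_on (D : Type) (f : infsubsets -> D) (A : set nat) : Prop :=
  forall B, box [::] A B -> exists n, forall C, box [::] A C ->
    agree n (val B) (val C) -> f C = f B.

(** The functions s are the coordinates of an injection of the range of f into
Baire space; continuity of each coordinate is all that the scheme needs. *)
Section Scheme.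
Context {D : Type} (f : infsubsets -> D) (A : set nat).
Context {I : Type} (s : I -> D -> nat).
Hypothesis s_inj : forall B C, (forall i, s i (f B) = s i (f C)) -> f B = f C.
Hypothesis s_cont : forall i, locally_constant_on (s i \o f) A.

Definition cylinder (t : seq nat) : set infsubsets :=
  box [::] A `&` [set B | agree (size t) (nth 0%N t) (val B)].

Definition large (t : seq nat) : Prop := ~ countable (f @` cylinder t).

(** Points with a prefix of countable image contribute countably many values in
all, so two points with distinct values remain among those without such a
prefix, and continuity separates the values on long enough prefixes. *)
Lemma large_split t : large t -> exists t0 t1, [/\ large t0, large t1,
  prefix t t0 /\ prefix t t1, (size t < size t0)%N /\ (size t < size t1)%N &
  forall B C, cylinder t0 B -> cylinder t1 C -> f B <> f C].
Proof.
move=> bt.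
pose pre n (B : infsubsets) := mkseq (val B) n.
have preP n B : box [::] A B -> cylinder (pre n B) B.
  by move=> AB; split=> // i; rewrite /= size_mkseq => ilt; rewrite nth_mkseq.
pose G := cylinder t `&` [set B | forall n, large (pre n B)].
have nG : ~ countable (f @` G).
  move=> cG; apply: bt.
  pose F (u : option (seq nat)) := if u is Some v
    then (if pselect (countable (f @` cylinder v)) then f @` cylinder v else set0) else f @` G.
  have : countable (\bigcup_u F u).
    by apply: bigcup_countable => // -[u|] _ //=; case: pselect.
  apply: sub_countable; apply: subset_card_le; move=> y [B tB <-{y}] .
  have [h|/existsNP[n /contrapT h]] := pselect (forall n, large (pre n B)).
    by exists None => //; exists B.
  exists (Some (pre n B)) => //=; case: pselect => //= _.
  by exists B => //; apply: preP; case: tB.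
have [B [C [GB GC fBC]]] : exists B C, [/\ G B, G C & f B <> f C].
  apply: contrapT => h; apply: nG.
  have [[B GB]|/forallNP nB] := pselect (exists B, G B); last first.
    have -> : f @` G = set0 by apply/seteqP; split=> // y [B /nB].
    exact: countable0.
  apply: (@sub_countable _ _ _ [set f B]); last exact: countable1.
  apply: subset_card_le => y [C GC <-{y}] /=; apply: contrapT => fBC.
  by apply: h; exists B, C; split=> // e; apply: fBC.
have /existsNP[i sBC] : ~ forall i, s i (f B) = s i (f C).
  by move=> /s_inj.
have [[[AB tB] bB] [[AC tC] bC]] := (GB, GC).
have [[n hn] [m hm]] := (s_cont i AB, s_cont i AC).
pose N := maxn (size t).+1 (maxn n m).
have tN : (size t < N)%N by exact: leq_maxl.
have pre_t (E : infsubsets) : agree (size t) (nth 0%N t) (val E) -> prefix t (pre N E).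
  move=> tE; apply/prefixP; exists (drop (size t) (pre N E)).
  rewrite -{1}(cat_take_drop (size t) (pre N E)); congr (_ ++ _).
  apply: (@eq_from_nth _ 0%N); first by rewrite size_take size_mkseq tN.
  move=> j; rewrite size_take size_mkseq tN => jt.
  by rewrite nth_take // nth_mkseq ?tE //; exact: ltn_trans tN.
exists (pre N B), (pre N C); split.
- exact: bB.
- exact: bC.
- by split; exact: pre_t.
- by rewrite !size_mkseq.
move=> E E' [AE BE] [AE' CE'] fE.
have agr k (X Y : infsubsets) : (k <= N)%N ->
    agree (size (pre N X)) (nth 0%N (pre N X)) (val Y) ->
    agree k (val X) (val Y).
  rewrite size_mkseq => kN XY j jk.
  have jN := leq_trans jk kN.
  by have := XY j jN; rewrite nth_mkseq.
apply: sBC; have := hn _ AE (agr n _ _ _ BE); have := hm _ AE' (agr m _ _ _ CE').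
rewrite /N !leq_max !leqnn !orbT /= => /(_ isT) <- /(_ isT) <-.
by rewrite fE.
Qed.

(** The perfect set theorem for the continuous image of a box. *)
Lemma cantor_scheme : ~ countable (f @` box [::] A) ->
  exists psi : (nat -> bool) -> infsubsets,
    (forall b b' n, agree n b b' -> agree n (val (psi b)) (val (psi b'))) /\
    (forall b b', f (psi b) = f (psi b') -> b =1 b').
Proof.
move=> ncA.
have large0 : large [::].
  suff e : cylinder [::] = box [::] A by rewrite /large e.
  by apply/seteqP; split=> [B []|B AB].
have : forall t : {t | large t}, exists p : {t | large t} * {t | large t},
    [/\ prefix (sval t) (sval p.1) /\ prefix (sval t) (sval p.2),
        (size (sval t) < size (sval p.1))%N /\ (size (sval t) < size (sval p.2))%N &
        forall B C, cylinder (sval p.1) B -> cylinder (sval p.2) C -> f B <> f C].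
  move=> [t bt]; have [t0 [t1 [b0 b1 p l h]]] := large_split bt.
  by exists (exist _ t0 b0, exist _ t1 b1).
move=> /choice[next nextP].
pose T (b : nat -> bool) := fix T n : {t | large t} :=
  if n is n'.+1 then (if b n' then (next (T n')).1 else (next (T n')).2)
  else exist _ [::] large0.
pose t b n := sval (T b n).
have t_agree b b' n : agree n b b' -> T b n = T b' n.
  elim: n => //= n IH h; rewrite h // IH // => i ilt; apply: h; exact: ltnW.
have t_prefix b n k : prefix (t b n) (t b (n + k)%N).
  elim: k => [|k IH]; first by rewrite addn0 prefix_refl.
  apply: prefix_trans IH _; rewrite addnS /t /=.
  by have [[p1 p2] _ _] := nextP (T b (n + k)%N); case: ifP.
have t_size b n : (n <= size (t b n))%N.
  elim: n => // n IH; apply: leq_ltn_trans IH _; rewrite /t /=.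
  by have [_ [p1 p2] _] := nextP (T b n); case: ifP.
have nth_prefix (u v : seq nat) i : prefix u v -> (i < size u)%N -> nth 0%N v i = nth 0%N u i.
  by move=> /prefixP[w ->] iu; rewrite nth_cat iu.
pose x b i := nth 0%N (t b i.+1) i.
have xE b n : agree (size (t b n)) (nth 0%N (t b n)) (x b).
  move=> i ilt; rewrite /x; have [ni|ni] := leqP n i.
    rewrite (nth_prefix (t b n) (t b i.+1)) //.
    by have := t_prefix b n (i.+1 - n)%N; rewrite subnKC // leqW.
  rewrite (nth_prefix (t b i.+1) (t b n)) ?t_size //.
  by have := t_prefix b i.+1 (n - i.+1)%N; rewrite subnKC.
have cylinder_neq0 b n : exists B, cylinder (t b n) B.
  apply: contrapT => /forallNP h; have := svalP (T b n); rewrite /large; apply.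
  have -> : f @` cylinder (sval (T b n)) = set0 by apply/seteqP; split=> // y [B /h].
  exact: countable0.
have x_lt b i : (x b i < x b i.+1)%N.
  have [B [_ Bt]] := cylinder_neq0 b i.+2; have sz := t_size b i.+2.
  rewrite -(xE b i.+2) ?(ltnW sz) // -(xE b i.+2) // !Bt ?(ltnW sz) //.
  exact: infsubsets_lt.
have xA b i : A (x b i).
  have [B [[_ AB] Bt]] := cylinder_neq0 b i.+1; have sz := t_size b i.+1.
  by rewrite -(xE b i.+1) // Bt //; exact: AB.
have /choice[psi psiE] : forall b, exists B : infsubsets, val B = x b.
  by move=> b; exact: infsubset_exists.
exists psi; split.
- move=> b b' n bb i ilt; rewrite !psiE /x /t (t_agree b b') // => j jlt; apply: bb.
  exact: leq_trans ilt.
have psi_cylinder b n : cylinder (t b n) (psi b).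
  by split; rewrite /box /= psiE; [split|exact: xE].
move=> b b' fbb n; elim/ltn_ind: n => n IH.
have TE : T b n = T b' n by exact: t_agree.
have [_ _ sep] := nextP (T b n).
have := psi_cylinder b n.+1; have := psi_cylinder b' n.+1; rewrite /t /= -TE.
by case: (b n); case: (b' n) => // c c'; [case: (sep _ _ c' c)|case: (sep _ _ c c')].
Qed.
End Scheme.

Lemma borel_map_agree (g : infsubsets -> infsubsets) :
  (forall n, exists m, forall B C : infsubsets,
     agree m (val B) (val C) -> agree n (val (g B)) (val (g C))) ->
  borel_map g.
Proof.
move=> gc; apply: borel_preimage => O /open_infsubsetsP oO.
apply: borel_open; apply/open_infsubsetsP => B /oO[n hn]; have [m hm] := gc n.
by exists m => C /hm /hn.
Qed.

Lemma countable_range_locally_constant (D : Type) (f : infsubsets -> D) A :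
  (forall E : set D, borel (f @^-1` E)) -> unbounded A ->
  countable (f @` box [::] A) ->
  exists A', [/\ A' `<=` A, unbounded A' & locally_constant_on f A'].
Proof.
move=> bf iA /countable_injP[g gI].
pose V n : set infsubsets := f @^-1` [set d | g d = n].
have [A1 [A1A iA1 hV]] := ramsey_fusion [::] (fun n => ramsey_borel (bf _ : borel (V n))) iA.
exists A1; split=> // B AB; exists (g (f B)) => C AC BC.
apply: gI; rewrite ?inE; first by exists C => //; exact: box_sub AC.
  by exists B => //; exact: box_sub AB.
exact: (hV (g (f B)) B C AB AC BC erefl).
Qed.

(** Although D may be uncountable, discreteness makes the preimages of all
subsets Borel, which is incompatible with an uncountable range. *)
Lemma borel_locally_constant (D : Type) (f : infsubsets -> D) :
  (forall E : set D, borel (f @^-1` E)) ->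
  exists A, unbounded A /\ locally_constant_on f A.
Proof.
move=> bf.
have /choice[r rP] : forall d, exists x : nat -> nat,
    (exists B, f B = d) -> exists B, f B = d /\ val B = x.
  move=> d; have [[B fB]|n] := pselect (exists B, f B = d).
    by exists (val B) => _; exists B.
  by exists id => /n.
pose s i d := r d i.
have s_inj B C : (forall i, s i (f B) = s i (f C)) -> f B = f C.
  move=> /funext e; have [B' [fB vB]] := rP (f B) (ex_intro _ B erefl).
  have [C' [fC vC]] := rP (f C) (ex_intro _ C erefl).
  suff BC : B' = C' by rewrite -fB -fC BC.
  by apply: val_inj; rewrite vB vC; exact: e.
pose V n : set infsubsets := if unpickle n is Some (i, m)
  then f @^-1` [set d | s i d = m] else set0.
have bV n : borel (V n).
  rewrite /V; case: unpickle => [[i m]|]; first exact: bf.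
  by apply: borel_open; exact: open0.
have [A [_ iA hA]] := ramsey_fusion [::] (fun n => ramsey_borel (bV n)) unboundedT.
have s_cont i : locally_constant_on (s i \o f) A.
  move=> B AB; exists (pickle (i, s i (f B))) => C AC BC.
  by have := hA _ B C AB AC BC; rewrite /V pickleK; apply.
have [cA|ncA] := pselect (countable (f @` box [::] A)).
  have [A1 [_ iA1 h]] := countable_range_locally_constant bf iA cA.
  by exists A1.
have [psi [psi_c psi_inj]] := cantor_scheme s_inj s_cont ncA.
(* The characteristic function of the range of B; the bound k.+1 suffices as
   the i-th element is at least i. *)
pose chi (B : infsubsets) k := has (fun i => val B i == k) (iota 0 k.+1).
have chiP B k : chi B k <-> range (val B) k.
  have B_ge i : (i <= val B i)%N.
    by elim: i => // i IH; apply: leq_ltn_trans IH (infsubsets_lt B _).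
  split=> [/hasP[i _ /eqP <-]|[i _ Bi]]; first by exists i.
  by apply/hasP; exists i; rewrite ?Bi ?eqxx // mem_iota /= add0n ltnS -Bi.
have chi_c n (B C : infsubsets) : agree n (val B) (val C) -> agree n (chi B) (chi C).
  move=> BC k kn; apply: eq_in_has => i; rewrite mem_iota /= add0n ltnS => ik.
  by rewrite BC //; exact: leq_ltn_trans kn.
have [G] := exists_non_ramsey; case; apply: ramsey_borel.
have -> : G = (psi \o chi) @^-1` (f @^-1` [set d | exists2 B, G B & d = f (psi (chi B))]).
  apply/seteqP; split=> [B GB|B [C GC /psi_inj e]]; first by exists B.
  suff -> : B = C by [].
  by apply: infsubset_range_inj; apply/seteqP; split=> k /chiP h; apply/chiP;
    rewrite ?e // -e.
apply: borel_map_agree (bf _) => n; exists n => B C BC.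
by apply: psi_c; exact: chi_c.
Qed.

(** * The game and the simultaneous play *)
Section Game.
Context {U Q : Type} (lt : U -> U -> Prop) (leQ : Q -> Q -> Prop) (l : U -> Q).
Hypothesis lt_trans : forall x y z, lt x y -> lt y z -> lt x z.

(** A strategy at the node x, when the next answer has to lie in Y. After the
answer v, the following answers have to lie strictly above v. That the type is
inductive is what makes the strategy winning. *)
Inductive strategy (x : U) (Y : set U) : Type :=
  Strategy (next : forall v, Y v -> leQ (l x) (l v) -> U)
    (next_lt : forall v Yv xv, lt x (@next v Yv xv))
    (follow : forall v Yv xv, strategy (@next v Yv xv) (lt v)).

Record state := State { pos : U; room : set U; plan : strategy pos room }.

Definition accepts (s s' : state) : Prop :=
  room s (pos s') /\ leQ (l (pos s)) (l (pos s')).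

Definition advance (x : U) (Y : set U) (p : strategy x Y) v
    (Yv : Y v) (xv : leQ (l x) (l v)) : state :=
  let: Strategy _ _ follow := p in State (follow v Yv xv).

Definition step (s s' : state) : state :=
  if pselect (accepts s s') is left a then advance (plan s) a.1 a.2 else s.

Lemma step_accepts s s' : accepts s s' ->
  lt (pos s) (pos (step s s')) /\ room (step s s') = lt (pos s').
Proof.
rewrite /step; case: pselect => // -[Yv xv] _.
by case: s Yv xv => x Y [next next_lt follow] Yv xv /=; split.
Qed.

Lemma step_id s s' : ~ accepts s s' -> step s s' = s.
Proof. by rewrite /step; case: pselect. Qed.

(** By induction on the strategy: each accepted offer leads into a proper
substrategy. The offers s' are arbitrary. *)
Lemma strategy_no_infinite_play (s : nat -> state) (s' : nat -> state) :
  (forall t, s t.+1 = step (s t) (s' t)) ->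
  exists t, forall t', (t <= t')%N -> ~ accepts (s t') (s' t').
Proof.
suff h x Y (p : strategy x Y) t0 :
    (forall t, s t.+1 = step (s t) (s' t)) -> s t0 = State p ->
    exists t, forall t', (t <= t')%N -> ~ accepts (s t') (s' t').
  by move=> sS; apply: (h _ _ (plan (s 0%N)) 0%N sS); case: (s 0%N).
elim: p t0 => {}x {}Y next next_lt follow IH t0 sS s0.
have [[t tt0 acc]|nacc] :=
    pselect (exists2 t, (t0 <= t)%N & accepts (s t) (s' t)); last first.
  by by exists t0 => t' tt' a; apply: nacc; exists t'.
pose P t := `[< (t0 <= t)%N /\ accepts (s t) (s' t) >].
have exP : exists t, P t by exists t; apply/asboolP.
case: (ex_minnP exP) => m /asboolP[m0 macc] mmin.
have sm : s m = State (Strategy next_lt follow).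
  have : forall k, (t0 + k <= m)%N -> s (t0 + k)%N = s t0.
    elim=> [|k IHk] km; first by rewrite addn0.
    rewrite addnS sS step_id; first by apply: IHk; rewrite ltnW // -addnS.
    move=> a; have : (m <= t0 + k)%N.
      by apply: mmin; apply/asboolP; split=> //; exact: leq_addr.
    by rewrite leqNgt -addnS km.
  by move=> /(_ (m - t0)%N); rewrite subnKC // s0; apply.
move: (sS m); rewrite /step; case: pselect => // -[Yv xv] sm1.
move: Yv xv sm1; rewrite sm /= => Yv xv sm1.
exact: IH sS sm1.
Qed.

(** At each time step game k examines the node at which game k.+1 stands. A game
makes at most one move per time step, so no node of game k.+1 is missed. *)
Fixpoint run (init : nat -> state) (t k : nat) : state :=
  if t is t'.+1 then step (run init t' k) (run init t' k.+1) else init k.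

Lemma run_slide init t k j : run (slide k init) t j = run init t (k + j).
Proof. by elim: t j => //= t IH j; rewrite !IH addnS. Qed.

Lemma run_agree init init' t k :
  (forall i, (i <= t)%N -> init (k + i)%N = init' (k + i)%N) ->
  run init t k = run init' t k.
Proof.
elim: t k => [|t IH] k h /=; first by have := h 0%N; rewrite addn0; apply.
rewrite !IH // => i it; last by apply: h; exact: leqW.
by rewrite addSnnS; apply: h.
Qed.

Section Run.
Variable init : nat -> state.
Let r := run init.
Let moves t k := accepts (r t k) (r t k.+1).

Lemma run_stable k t : (forall t', (t <= t')%N -> ~ moves t' k) ->
  forall t', (t <= t')%N -> r t' k = r t k.
Proof.
move=> nm t' /subnKC <-; elim: (t' - t)%N => [|n IH]; first by rewrite addn0.
by rewrite addnS /r /= step_id ?IH //; apply: nm; exact: leq_addr.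
Qed.

Lemma run_limit k : exists t, forall t', (t <= t')%N -> r t' k = r t k.
Proof.
have [|t h] := @strategy_no_infinite_play (r^~ k) (r^~ k.+1); first by [].
by exists t; exact: run_stable h.
Qed.

Lemma run_pos_le k t t' : (t <= t')%N ->
  pos (r t k) = pos (r t' k) \/ lt (pos (r t k)) (pos (r t' k)).
Proof.
move=> /subnKC <-; elim: (t' - t)%N => [|n IH]; first by rewrite addn0; left.
rewrite addnS /r /= -/r; have [/step_accepts[h _]|/step_id ->//] := pselect (moves (t + n) k).
by right; case: IH => [->//|/lt_trans]; exact.
Qed.

Hypothesis init_room : forall k v,
  pos (init k.+1) = v \/ lt (pos (init k.+1)) v -> room (init k) v.

(** If the final label of game k is below that of game k.+1, then the final
node of game k.+1 lies outside the final room of game k. As that room consists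
of the nodes above the last answer used, game k.+1 made no move from the time
of that answer on. So the time after which nothing moves decreases from k to
k.+1, and the induction on it below excludes that this goes on for all k. *)
Lemma run_limits_bad (fin : nat -> state) :
  (forall k, exists t, forall t', (t <= t')%N -> r t' k = fin k) ->
  forall k0, exists2 k, (k0 <= k)%N & ~ leQ (l (pos (fin k))) (l (pos (fin k.+1))).
Proof.
move=> finP k0; apply: contrapT => nbad.
have good k : (k0 <= k)%N -> ~ room (fin k) (pos (fin k.+1)).
  move=> kk rk; have [t h] := @strategy_no_infinite_play (r^~ k) (r^~ k.+1) (fun=> erefl).
  have [[t1 h1] [t2 h2]] := (finP k, finP k.+1).
  pose m := maxn t (maxn t1 t2); apply: (h m); first exact: leq_maxl.
  rewrite h1 ?h2 /m ?leq_max ?leqnn ?orbT //; split=> //.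
  by apply: contrapT => bad; apply: nbad; exists k.
have fin_le k t : pos (r t k) = pos (fin k) \/ lt (pos (r t k)) (pos (fin k)).
  have [t' h] := finP k; rewrite -(h (maxn t t')) ?leq_maxr //.
  by apply: run_pos_le; exact: leq_maxl.
have finE k t : (forall t', (t <= t')%N -> ~ moves t' k) -> fin k = r t k.
  move=> nm; have [t' h] := finP k; rewrite -(h (maxn t t')) ?leq_maxr //.
  by apply: run_stable nm _ _; exact: leq_maxl.
have never tau : forall k, (k0 <= k)%N -> ~ (forall t, (tau <= t)%N -> ~ moves t k).
  elim: tau => [|tau IH] k kk nm.
    by apply: (good k kk); rewrite (finE _ _ nm); apply: init_room; exact: (fin_le k.+1 0%N).
  have [mv|nmv] := pselect (moves tau k); last first.
    apply: (IH k kk) => t; rewrite leq_eqVlt => /orP[/eqP <- //|]; exact: nm.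
  have [_ rE] := step_accepts mv.
  apply: (IH k.+1 (leqW kk)) => t tt mv'; apply: (good k kk).
  rewrite (finE _ _ nm) /r /= -/r rE.
  have [lt1 _] := step_accepts mv'.
  have lt2 : lt (pos (r t k.+1)) (pos (fin k.+1)).
    by case: (fin_le k.+1 t.+1) => [<-//|]; exact: lt_trans lt1.
  by case: (run_pos_le k.+1 tt) => [->//|/lt_trans]; exact.
have [t h] : exists t, forall t', (t <= t')%N -> ~ moves t' k0.
  exact: (@strategy_no_infinite_play (r^~ k0) (r^~ k0.+1)).
exact: (never t k0 (leqnn _) h).
Qed.
End Run.
End Game.

(** * The game on labelled trees *)
Lemma finite_max (T : Type) (le : T -> T -> Prop) (S : set T) :
  (forall x y z, le x y -> le y z -> le x z) -> (forall x, le x x) ->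
  (forall x y, S x -> S y -> le x y \/ le y x) ->
  finite_set S -> S !=set0 -> exists2 m, S m & forall x, S x -> le x m.
Proof.
elim/Pchoice: T => T in le S * => le_trans le_refl.
move=> + /finite_seqP[s sS]; rewrite {}sS; elim: s => [|x s IH] tot [y]; first by [].
move=> _; have [[z zs]|/forallNP s0] := pselect (exists z, z \in s); last first.
  exists x => [|z]; rewrite /= inE ?eqxx // => /orP[/eqP ->|/s0//]; exact: le_refl.
have [|m ms mmax] := IH _ (ex_intro _ z zs).
  by move=> a b as_ bs; apply: tot; rewrite /= inE ?as_ ?bs orbT.
have [xm|mx] := tot x m (mem_head _ _) (mem_behead (s := x :: s) ms).
  exists m => [|a]; rewrite /= inE ?ms ?orbT // => /orP[/eqP ->//|]; exact: mmax.
exists x => [|a]; rewrite /= inE ?eqxx // => /orP[/eqP -> //|/mmax am].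
exact: le_trans mx.
Qed.

Section Trees.
Context {Q : Type} (leQ : Q -> Q -> Prop).
Implicit Types T : labeled_tree Q.

Lemma node_le_trans T (x y z : node T) : node_le x y -> node_le y z -> node_le x z.
Proof. by have [[_ tr _] _ _] := node_tree T; exact: tr. Qed.

Lemma node_le_refl T (x : node T) : node_le x x.
Proof. by have [[re _ _] _ _] := node_tree T; exact: re. Qed.

Lemma node_le_anti T (x y : node T) : node_le x y -> node_le y x -> x = y.
Proof. by have [[_ _ an] _ _] := node_tree T; exact: an. Qed.

Lemma node_lt_trans T (x y z : node T) : node_lt x y -> node_lt y z -> node_lt x z.
Proof.
move=> [xy nxy] [yz nyz]; split; first exact: node_le_trans yz.
by move=> xz; apply: nxy; apply: node_le_anti => //; rewrite xz.
Qed.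

Lemma node_lt_wf T : well_founded (@node_lt Q T).
Proof.
move=> t; apply: contrapT => nt; have [_ wo _] := node_tree T.
have [||m [mt nm] mmin] := wo t [set v | node_le v t /\ ~ Acc (@node_lt Q T) v].
- by move=> v [].
- by exists t; split=> //; exact: node_le_refl.
apply: nm; split=> v [vm nvm]; apply: contrapT => nv; apply: nvm.
apply: node_le_anti => //; apply: mmin; split=> //.
exact: node_le_trans mt.
Qed.

(** Finite heights are used here: a node other than the root has an immediate
predecessor, along which an embedding can be defined recursively. *)
Lemma node_pred T (x : node T) :
  (exists p, node_lt p x /\ forall v, node_lt v x -> node_le v p) \/
  (forall v, node_le x v).
Proof.
have [_ wo [r rP]] := node_tree T.
have [<-|rx] := pselect (r = x); [by right|left].
have [|||||m mx mmax] := @finite_max (node T) (@node_le Q T) [set v | node_lt v x].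
- exact: node_le_trans.
- exact: node_le_refl.
- move=> v w [vx _] [wx _].
  have [|m mvw mmin] := wo x [set u | u = v \/ u = w] _ (ex_intro _ v (or_introl erefl)).
    by move=> u /= [->|->].
  by case: mvw mmin => -> mmin; [left|right]; apply: mmin; [right|left].
- exact: node_height.
- by exists r; split.
- by exists m.
Qed.

(** All trees are put into one forest, so that positions of games on different
trees have the same type. *)
Definition gnode := {T : labeled_tree Q & node T}.

Definition glt (u v : gnode) : Prop :=
  exists e : projT1 u = projT1 v,
    node_lt (ecast W (node W) e (projT2 u)) (projT2 v).

Definition glabel (u : gnode) : Q := node_label (projT2 u).

Lemma glt_trans u v w : glt u v -> glt v w -> glt u w.
Proof.
case: u v w => [T x] [T' y] [T'' z] [/= e]; case: T' / e y => y xy.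
by case=> /= e; case: T'' / e z => z yz; exists erefl; exact: node_lt_trans yz.
Qed.

Lemma gltP T (x y : node T) : glt (existT _ T x) (existT _ T y) <-> node_lt x y.
Proof.
split=> [[/= e]|xy]; last by exists erefl.
by rewrite (Prop_irrelevance e erefl).
Qed.

Definition nodes T : set gnode := [set u | projT1 u = T].

Definition wins (x : gnode) (Y : set gnode) : Prop :=
  inhabited (strategy glt leQ glabel x Y).

(** The positions that are not winning for the first player admit an answer that
keeps them so, whichever node above x is visited next. *)
Lemma winsPn T (x : node T) Y : ~ wins (existT _ T x) Y ->
  exists v, [/\ Y v, leQ (node_label x) (glabel v) &
    forall x' : node T, node_lt x x' -> ~ wins (existT _ T x') (glt v)].
Proof.
move=> nw; apply: contrapT => nv; apply: nw.
have h v : Y v -> leQ (node_label x) (glabel v) ->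
    {x' : gnode | glt (existT _ T x) x' /\ wins x' (glt v)}.
  move=> Yv xv; apply: cid; apply: contrapT => nx; apply: nv.
  exists v; split=> // x' xx' w; apply: nx; exists (existT _ T x').
  by split=> //; exact/gltP.
pose next v Yv xv := sval (h v Yv xv).
have next_lt v Yv xv : glt (existT _ T x) (@next v Yv xv).
  by case: (svalP (h v Yv xv)).
have follow v Yv xv : strategy glt leQ glabel (@next v Yv xv) (glt v).
  by have [_ w] := svalP (h v Yv xv); exact: inhabited_witness.
by constructor; exact: Strategy next_lt follow.
Qed.

(** If the first player does not win, answering so as to stay in positions that
are not winning defines, by recursion along predecessors, an embedding. *)
Lemma wins_root T1 T2 (r : node T1) : (forall x, node_le r x) ->
  ~ ltree_le1 leQ T1 T2 -> wins (existT _ T1 r) (nodes T2).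
Proof.
move=> rP nle; apply: contrapT => nw; apply: nle.
pose room (y : option (node T2)) : set gnode :=
  if y is Some y0 then glt (existT _ T2 y0) else nodes T2.
have /choice[ans ansP] : forall xy : node T1 * option (node T2), exists v : node T2,
    ~ wins (existT _ T1 xy.1) (room xy.2) ->
    [/\ forall y, xy.2 = Some y -> node_lt y v, leQ (node_label xy.1) (node_label v) &
      forall x', node_lt xy.1 x' -> ~ wins (existT _ T1 x') (room (Some v))].
  move=> [x y] /=; have [w|/winsPn[[T v] [Yv xv h]]] :=
      pselect (wins (existT _ T1 x) (room y)).
    by have [_ _ [r2 _]] := node_tree T2; exists r2 => /(_ w).
  have e : T2 = T by case: y Yv h => [y [/= e]|//] _ _; rewrite e.
  case: T / e v Yv xv h => v Yv xv h; exists v => _; split=> //.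
  by move=> y' y'E; apply/gltP; move: Yv; rewrite y'E.
have /choice[pred predP] : forall x : node T1, exists p : option (node T1),
    if p is Some p0 then node_lt p0 x /\ forall v, node_lt v x -> node_le v p0
    else forall v, node_le x v.
  by move=> x; have [[p h]|h] := node_pred x; [exists (Some p)|exists None].
have [f fE] : exists f : node T1 -> node T2, forall x, f x = ans (x, omap f (pred x)).
  pose F x (rec : forall p, node_lt p x -> node T2) : node T2 :=
    ans (x, match pred x as o return
        (if o is Some p0 then node_lt p0 x /\ forall v, node_lt v x -> node_le v p0
         else forall v, node_le x v) -> option (node T2) with
      | Some p => fun h => Some (rec p h.1)
      | None => fun=> None
      end (predP x)).
  exists (Fix (@node_lt_wf T1) (fun=> node T2) F) => x.
  rewrite Fix_eq; last first.
    move=> y g g' gg; suff -> : g = g' by [].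
    by apply: functional_extensionality_dep => p; apply: funext.
  by rewrite {1}/F; congr (ans (x, _)); move: (predP x); case: (pred x).
have nwx x : ~ wins (existT _ T1 x) (room (omap f (pred x))).
  elim/(well_founded_ind (@node_lt_wf T1)): x => x IH.
  have := predP x; case: (pred x) => [p [px pmax]|xmin] /=.
    by have [_ _] := ansP (p, omap f (pred p)) (IH p px); rewrite -fE; exact.
  by rewrite (_ : x = r) //; exact: node_le_anti.
have f_ans x := ansP (x, omap f (pred x)) (nwx x).
exists f; split=> [x y xy|x]; last by have [_ + _] := f_ans x; rewrite -fE.
elim/(well_founded_ind (@node_lt_wf T1)): y xy => y IH xy.
have := f_ans y; rewrite -fE; have := predP y.
case: (pred y) => [p [py pmax]|ymin] /= [].
  move=> /(_ _ erefl) fpy _ _; have [->//|xp] := pselect (x = p).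
  by apply: node_lt_trans fpy; apply: IH => //; split=> //; exact: pmax.
by case: xy => xy nxy; case: nxy; apply: node_le_anti => //; exact: ymin.
Qed.

Definition bad_sequence (D : Type) (leD : D -> D -> Prop) (X : nat -> D) : Prop :=
  forall k, ~ leD (X k) (X k.+1).

(** The interface between the game and the descriptive arguments: bad sequences
in D are turned, continuously up to one limit and compatibly with the shift, into
sequences in Q that are bad at infinitely many places. *)
Definition limit_reduction (D : Type) (leD : D -> D -> Prop)
    (q : nat -> (nat -> D) -> Q) : Prop :=
  (forall t X X', agree t.+2 X X' -> q t X = q t X') /\
  (forall X, bad_sequence leD X -> exists z : nat -> Q,
     (forall k, exists t, forall t', (t <= t')%N -> q t' (slide k X) = z k) /\
     forall k0, exists2 k, (k0 <= k)%N & ~ leQ (z k) (z k.+1)).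

(** Trees reduce to their labels by the simultaneous play. *)
Lemma tree_limit_reduction : exists q, limit_reduction (@ltree_le1 Q leQ) q.
Proof.
have exroot T : exists r : node T, forall u, node_le r u.
  by have [_ _ [r rP]] := node_tree T; exists r.
pose root T : gnode := existT _ T (sval (cid (exroot T))).
have /choice[init initP] : forall TT : labeled_tree Q * labeled_tree Q,
    exists s : state glt leQ glabel, pos s = root TT.1 /\
      (~ ltree_le1 leQ TT.1 TT.2 -> room s = nodes TT.2).
  move=> [T1 T2] /=.
  have [le|nle] := pselect (ltree_le1 leQ T1 T2).
    (* The initial state has to be defined for all pairs of trees; in an empty
       room there is nothing to answer. *)
    have p : strategy glt leQ glabel (root T1) set0.
      by apply: (@Strategy _ _ _ _ _ _ _ (fun v (Yv : set0 v) _ => False_rect _ Yv)).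
    by exists (State p); split=> // /(_ le).
  have [p] := wins_root (svalP (cid (exroot T1))) nle.
  by exists (State p).
pose inits (X : nat -> labeled_tree Q) k := init (X k, X k.+1).
exists (fun t X => glabel (pos (run (inits X) t 0%N))); split.
  move=> t X X' XX'; congr (glabel (pos _)); apply: run_agree => i it.
  by rewrite /inits add0n !XX' // ltnS // ltnW.
move=> X bX.
have /choice[fin finP] := @run_limit _ _ glt leQ glabel (inits X).
exists (fun k => glabel (pos (run (inits X) (fin k) k))); split.
  move=> k; exists (fin k) => t' ft'.
  have -> : inits (slide k X) = slide k (inits X).
    by apply: funext => i; rewrite /inits /slide addnS.
  by rewrite run_slide addn0 finP.
apply: (@run_limits_bad _ _ _ _ _ glt_trans (inits X) _ (fun k => run (inits X) (fin k) k)).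
  move=> k v; rewrite /inits; have [-> _] := initP (X k.+1, X k.+2).
  have [_ ->] := initP (X k, X k.+1); last exact: (bX k).
  by move=> [<-//|[e _]]; exact: esym e.
by move=> k; exists (fin k) => t' /finP.
Qed.

End Trees.

(** * Borel colourings *)
Lemma borel_limit (V : topologicalType) (W : Type) (a : nat -> V -> W) (z : V -> W) :
  (forall X, exists t, forall t', (t <= t')%N -> a t' X = z X) ->
  (forall t E, borel [set X | E (a t X)]) ->
  forall E : set W, borel [set X | E (z X)].
Proof.
move=> az ba E.
have -> : [set X | E (z X)] =
    \bigcup_s \bigcap_t ([set _ | (t < s)%N] `|` [set X | E (a t X)]).
  apply/seteqP; split=> [X /= EX|X [s _ h]].
    have [s hs] := az X; exists s => // t _ /=.
    by have [st|ts] := leqP s t; [right; rewrite hs|left].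
  have [s' hs'] := az X; have := h (maxn s s') I => /= -[|].
    by rewrite ltnNge leq_maxl.
  by rewrite hs' // leq_maxr.
apply: borel_bigcup => s; apply: borel_bigcap => t.
by apply: borelU => //; exact: borel_cst.
Qed.

(** If every orbit of S meets and leaves E, it passes infinitely often from the
complement of E into E. Colour the points just before such a passage by 2, and
the others by the parity of the distance to the next one: there are never two
passages in succession. *)
Section ThreeColours.
Context {V : topologicalType} (S : V -> V) (E : set V).
Hypothesis S_borel : borel_map S.
Hypothesis E_borel : borel E.
Hypothesis E_hit : forall X, exists j, E (iter j S X).
Hypothesis E_miss : forall X, exists j, ~ E (iter j S X).

Let R X := ~ E X /\ E (S X).

Let R_hit X : exists j, `[< R (iter j S X) >].
Proof.
have [j nE] := E_miss X; have [j' Ej'] := E_hit (iter j S X).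
move: Ej'; rewrite -iterD; elim: j' => [//|j' IH] h.
have [/IH//|nE'] := pselect (E (iter (j' + j) S X)).
by exists (j' + j)%N; apply/asboolP; split.
Qed.

Let b X := ex_minn (R_hit X).

Let b_eq X : (b X == 0%N) = `[< R X >].
Proof.
rewrite /b; case: ex_minnP => -[|m] Rm min; first by rewrite Rm.
by apply/esym/negP => /(min 0%N).
Qed.

Let b_S X : b X != 0%N -> b X = (b (S X)).+1.
Proof.
rewrite /b; case: ex_minnP => -[//|m] Rm min _; case: ex_minnP => m' Rm' min'.
apply/eqP; rewrite eqn_leq; apply/andP; split.
  by apply: min; rewrite iterSr.
by rewrite ltnS; apply: min'; rewrite -iterSr.
Qed.

Lemma three_colouring : exists2 col : V -> discrete_topology 'I_3,
  borel_map col & forall X, col X <> col (S X).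
Proof.
pose h n : 'I_3 := if n == 0%N then inord 2 else inord (odd n).
exists (h \o b) => [B _|X].
  have -> : (h \o b) @^-1` B = \bigcup_n ([set _ | B (h n)] `&` [set X | b X = n]).
    apply/seteqP; split=> [X BX|X [n _ [/= Bn bX]]]; last by rewrite /= bX.
    by exists (b X).
  apply: borel_bigcup => n; apply: borelI; first exact: borel_cst.
  elim: n => [|n IH].
    have -> : [set X | b X = 0%N] = (~` E) `&` S @^-1` E.
      apply/seteqP; split=> X /=; first by move=> /eqP; rewrite b_eq => /asboolP.
      by move=> RX; apply/eqP; rewrite b_eq; apply/asboolP.
    by apply: borelI; [exact: borelC|exact: S_borel].
  have -> : [set X | b X = n.+1] = ~` ((~` E) `&` S @^-1` E) `&` S @^-1` [set X | b X = n].
    apply/seteqP; split=> X /=.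
      move=> bX; split; last by have := @b_S X; rewrite bX => /(_ isT)[].
      by move=> RX; have := b_eq X; rewrite bX /= => /esym/asboolP; apply.
    move=> [nR bS]; rewrite b_S ?bS // b_eq; exact/asboolP.
  apply: borelI; last exact: S_borel.
  by apply: borelC; apply: borelI; [exact: borelC|exact: S_borel].
rewrite /= /h => /(congr1 val); have [b0|b0] := eqVneq (b X) 0%N.
  have : b (S X) != 0%N.
    by rewrite b_eq; apply/asboolP => -[nE _]; move/eqP: b0; rewrite b_eq => /asboolP[].
  by move=> /negPf ->; rewrite /= !inordK //; case: odd.
rewrite (b_S b0); have [->|b1] := eqVneq (b (S X)) 0%N; rewrite /= !inordK //; by case: odd.
Qed.
End ThreeColours.

Section Discrete.
Import Order.TTheory GRing.Theory Num.Theory.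
Local Open Scope ring_scope.

Lemma polish_discrete (T : choiceType) : countable [set: T] ->
  polish (discrete_topology T).
Proof.
move=> cT; split.
  exists setT => // U [x Ux] _; by exists x.
exists (fun x y : T => ((x != y)%:R : Rdefinitions.R)); split.
- split=> [x y|x y|x y|x y z].
  + exact: ler0n.
  + have [->|xy] := eqVneq x y; first by [].
    by split=> [/eqP|e]; [rewrite pnatr_eq0|move: xy; rewrite e eqxx].
  + by rewrite eq_sym.
  + have [->|xz] := eqVneq x z; first by rewrite addr_ge0 ?ler0n.
    have [xy|xy] := eqVneq x y; last by rewrite lerDl ler0n.
    by rewrite -xy xz add0r.
- move=> U; split=> _; last exact: discrete_open.
  move=> x Ux; exists 1; first exact: ltr01.
  by move=> y /=; have [<-|xy] := eqVneq x y; rewrite ?ltxx.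
- move=> u h; have [N hN] := h 1 ltr01; exists (u N) => e e0; exists N => n Nn.
  by have := hN n N Nn (leqnn N); have [_|] := eqVneq (u n) (u N); rewrite ?ltxx.
Qed.

Lemma polish_set1 (T : topologicalType) (y : T) : polish T -> borel [set y].
Proof.
move=> [_ [d [[d0 dE _ _] dU _]]]; rewrite -[X in borel X]setCK.
apply: borelC; apply: borel_open; apply/dU => x /= xy; exists (d x y).
  by rewrite lt_neqAle d0 andbT eq_sym; apply/eqP => /dE.
by move=> z /= + zy; rewrite zy ltxx.
Qed.
End Discrete.

(** Since only finite cardinals are in question, a Polish space of least
cardinality exists by the well-ordering of the natural numbers. *)
Lemma borel_chromatic_leP (V : topologicalType) (E : V -> V -> Prop) n :
  borel_chromatic_le E n <->
  exists Y : topologicalType, borel_colorable E Y /\ ([set: Y] #<= `I_n)%card.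
Proof.
split=> [[Y [cY _] Yn]|[Y [cY Yn]]]; first by exists Y.
have fY : finite_set [set: Y] by apply/finite_set_leP; exists n.
pose P m := `[< exists Y : topologicalType, borel_colorable E Y /\ ([set: Y] #= `I_m)%card >].
have exP : exists m, P m.
  by have /finite_setP[m Ym] := fY; exists m; apply/asboolP; exists Y.
case: (ex_minnP exP) => m /asboolP[Y' [cY' Ym']] min.
have PZ (Z : topologicalType) : borel_colorable E Z -> ([set: Y'] #<= [set: Z])%card.
  move=> cZ; have [fZ|/infiniteP iZ] := pselect (finite_set [set: Z]); last first.
    apply: card_le_trans iZ; have : finite_set [set: Y'] by exists m.
    exact: finite_set_countable.
  have /finite_setP[k Zk] := fZ.
  rewrite (card_le_eql Ym') (card_le_eqr Zk) card_le_II; apply: min.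
  by apply/asboolP; exists Z.
by exists Y'; [split|exact: card_le_trans (PZ _ cY) Yn].
Qed.

Lemma open_vecP (D : Type) (leD : D -> D -> Prop) (U : set (vec leD)) :
  open U <-> forall X : vec leD, U X ->
    exists n, forall X' : vec leD, agree n (val X) (val X') -> U X'.
Proof.
apply: (@open_prefixP (discrete_topology {classic D})) => A; exact: discrete_open.
Qed.

Lemma vec_exists (D : Type) (leD : D -> D -> Prop) (x : nat -> D) :
  bad_sequence leD x -> exists X : vec leD, val X = x.
Proof.
move=> bx; have xP : (x : baire D) \in vec leD by rewrite inE.
by exists (exist _ (x : baire D) xP).
Qed.

Lemma vec_bad (D : Type) (leD : D -> D -> Prop) (X : vec leD) : bad_sequence leD (val X).
Proof. exact: (set_valP X). Qed.

Section Colouring.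
Context {D Q : Type} (leD : D -> D -> Prop) (leQ : Q -> Q -> Prop).
Context (q : nat -> (nat -> D) -> Q).
Hypothesis Q_countable : countable [set: Q].
Hypothesis leQ_refl : forall x, leQ x x.
Hypothesis qP : limit_reduction leQ leD q.

Notation V := (vec leD).
Notation W := (vec leQ).

Lemma limit_sequence : exists z : V -> nat -> Q,
  (forall X k, exists t, forall t', (t <= t')%N -> q t' (slide k (val X)) = z X k) /\
  (forall X k0, exists2 k, (k0 <= k)%N & ~ leQ (z X k) (z X k.+1)).
Proof.
have /choice[z zP] : forall X : V, exists z : nat -> Q,
     (forall k, exists t, forall t', (t <= t')%N -> q t' (slide k (val X)) = z k) /\
     forall k0, exists2 k, (k0 <= k)%N & ~ leQ (z k) (z k.+1).
  by move=> X; apply: qP.2; exact: vec_bad.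
by exists z; split=> X; [exact: (zP X).1|exact: (zP X).2].
Qed.

Lemma vec_shift : exists S : V -> V,
  (forall X, val (S X) = Defs.shift (val X)) /\ borel_map S.
Proof.
have /choice[S SE] : forall X : V, exists Y : V, val Y = Defs.shift (val X).
  by move=> X; apply: (@vec_exists D leD (Defs.shift (val X))) => k;
    have := @vec_bad D leD X k.+1.
exists S; split=> //; apply: borel_preimage => O /open_vecP oO.
apply: borel_open; apply/open_vecP => X /= /oO[n h]; exists n.+1 => X' XX'.
by apply: h => i i_n; rewrite !SE; exact: XX'.
Qed.

(** On the set V1 of those X for which z is eventually bad, E records, as soon as
z is bad from there on, the rises of the colouring of Q along z; off V1 it
records where z is bad. *)
Lemma countable_thin_transfer : countable_thin leQ -> countable_thin leD.
Proof.
have [z [z_lim z_bad]] := limit_sequence.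
have [S [SE Sb]] := vec_shift.
have iterE j X : val (iter j S X) = slide j (val X).
  elim: j => // j IH; rewrite iterS SE IH; apply: funext => i.
  by rewrite /Defs.shift /slide addSnnS.
have z_iter X j k : z (iter j S X) k = z X (j + k)%N.
  have [[t ht] [t' ht']] := (z_lim (iter j S X) k, z_lim X (j + k)%N).
  rewrite -(ht (maxn t t')) ?leq_maxl // -(ht' (maxn t t')) ?leq_maxr // iterE.
  by congr (q _ _); apply: funext => i; rewrite /slide addnA.
have bz2 k k' (P : set (Q * Q)) : borel [set X | P (z X k, z X k')].
  apply: (@borel_limit V _ (fun t X => (q t (slide k (val X)), q t (slide k' (val X))))
    (fun X => (z X k, z X k'))).
    move=> X; have [[t ht] [t' ht']] := (z_lim X k, z_lim X k').
    exists (maxn t t') => t''; rewrite geq_max => /andP[h h'].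
    by rewrite ht // ht'.
  move=> t P'; apply: borel_open; apply/open_vecP => X /= PX.
  exists (maxn k k' + t.+2)%N => X' XX'.
  have slideE j : (j <= maxn k k')%N ->
      q t (slide j (val X)) = q t (slide j (val X')).
    move=> jk; apply: qP.1 => i it; apply: XX'.
    by rewrite -addnS; exact: leq_add.
  by rewrite -!slideE ?leq_maxl ?leq_maxr.
have bz k (P : set Q) : borel [set X | P (z X k)] := bz2 k k (fun p => P p.1).
pose N k : set V := [set X | ~ leQ (z X k) (z X k.+1)].
have bN k : borel (N k) := bz2 k k.+1 (fun p => ~ leQ p.1 p.2).
move=> /borel_chromatic_leP[Y [[pY [c [bc cadj]]] Y3]].
have [rk [rk_inj rk3]] : exists rk : Y -> nat, injective rk /\ forall y, (rk y < 3)%N.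
  have /pcard_leP[f] := Y3; exists f; split=> [y y' yy'|y].
    by apply: (@inj _ _ _ f) => //; rewrite inE.
  exact: (@funS _ _ _ _ f y).
have brk i : borel [set w : W | rk (c w) = i].
  apply: (bc [set y | rk y = i]); have [[y <-]|/forallNP ny] := pselect (exists y, rk y = i).
    have -> : [set y' | rk y' = rk y] = [set y].
      by apply/seteqP; split=> [y' /= /rk_inj|y' ->].
    exact: polish_set1.
  have -> : [set y' | rk y' = i] = set0 by apply/seteqP; split=> y' // /ny.
  by apply: borel_open; exact: open0.
(* [pull j B]: the j-th tail of z is a vertex of the graph of Q and lies in B.
   Countability of Q makes open subsets of that graph countable unions of
   cylinders, whose preimages under z are Borel. *)
pose pull j (B : set W) : set V := [set X | exists2 w : W, val w = slide j (z X) & B w].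
have bpullT j : borel (pull j setT).
  have -> : pull j setT = \bigcap_k N (j + k)%N.
    apply/seteqP; split=> [X [w wE _] k _|X h].
      by have := @vec_bad _ _ w k; rewrite wE /slide addnS.
    have [|w wE] := @vec_exists _ leQ (slide j (z X)).
      by move=> k; have := h k I; rewrite /N /slide addnS.
    by exists w.
  by apply: borel_bigcap.
have /countable_injP[g g_inj] := Q_countable.
have bpull j (B : set W) : borel B -> borel (pull j B).
  move: B; apply: smallest_sub; last first.
    move=> B /open_vecP oB /=.
    pose good (u : seq nat) := forall w : W, agree (size u) (g \o val w) (nth 0%N u) -> B w.
    pose F n : set V := if unpickle n is Some u then
      [set _ | good u] `&`
      \bigcap_i [set X | (i < size u)%N -> g (z X (j + i)%N) = nth 0%N u i]
      else set0.
    have -> : pull j B = pull j setT `&` \bigcup_n F n.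
      apply/seteqP; split=> [X [w wE Bw]|X [[w wE _] [n _]]].
        split; first by exists w.
        have [n hn] := oB w Bw; pose u := mkseq (g \o val w) n.
        exists (pickle u) => //; rewrite /F pickleK; split.
          move=> w' w'u; apply: hn => i i_n; apply: g_inj; rewrite ?inE //.
          have iu : (i < size u)%N by rewrite size_mkseq.
          by have := w'u i iu; rewrite /u nth_mkseq.
        by move=> i _ /=; rewrite size_mkseq => i_n; rewrite nth_mkseq //= wE.
      rewrite /F; case: unpickle => // u [gu hu]; exists w => //.
      by apply: gu => i iu; rewrite -(hu i) //= wE.
    apply: borelI => //; apply: borel_bigcup => n; rewrite /F.
    case: unpickle => [u|]; last by apply: borel_open; exact: open0.
    apply: borelI; first exact: borel_cst.
    apply: borel_bigcap => i.
    exact: (bz (j + i)%N (fun y => (i < size u)%N -> g y = nth 0%N u i)).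
  split => /=.
  - have -> : pull j set0 = set0 by apply/seteqP; split=> // X [].
    by apply: borel_open; exact: open0.
  - move=> B bB; have -> : pull j (setT `\` B) = pull j setT `&` ~` pull j B.
      apply/seteqP; split=> [X [w wE [_ nB]]|X [[w wE _] nB]].
        split; first by exists w.
        by move=> [w' w'E]; rewrite (_ : w' = w) //; apply: val_inj; rewrite wE.
      by exists w => //; split=> // Bw; apply: nB; exists w.
    by apply: borelI => //; exact: borelC.
  - move=> B bB; have -> : pull j (\bigcup_n B n) = \bigcup_n pull j (B n).
      apply/seteqP; split=> [X [w wE [n _ Bw]]|X [n _ [w wE Bw]]].
        by exists n => //; exists w.
      by exists w => //; exists n.
    exact: borel_bigcup.
pose V1 : set V := \bigcup_m \bigcap_k [set X | (m <= k)%N -> N k X].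
have bV1 : borel V1.
  apply: borel_bigcup => m; apply: borel_bigcap => k.
  exact: (bz2 k k.+1 (fun p => (m <= k)%N -> ~ leQ p.1 p.2)).
pose C j i := pull j [set w | rk (c w) = i].
have bC j i : borel (C j i) by apply: bpull; exact: brk.
pose E : set V := (~` V1 `&` N 0%N) `|`
  \bigcup_i \bigcup_i' ([set _ | (i < i')%N] `&` (C 0%N i `&` C 1%N i')).
have bE : borel E.
  apply: borelU; first by apply: borelI => //; exact: borelC.
  apply: borel_bigcup => i; apply: borel_bigcup => i'.
  by apply: borelI; [exact: borel_cst|exact: borelI].
have V1_iter X j : V1 (iter j S X) -> V1 X.
  move=> [m _ h]; exists (j + m)%N => // k _ /= jmk.
  have jk : (j <= k)%N by apply: leq_trans jmk; exact: leq_addr.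
  have := h (k - j)%N I; rewrite /N /= !z_iter addnS subnKC //; apply.
  by rewrite leq_subRL.
have iter_V1 X j : V1 X -> V1 (iter j S X).
  move=> [m _ h]; exists m => // k _ /= mk.
  rewrite /N /= !z_iter addnS; apply: (h (j + k)%N I).
  by apply: leq_trans mk _; exact: leq_addl.
have N_iter X j : N 0%N (iter j S X) <-> N j X by rewrite /N /= !z_iter addn0 addn1.
have pull_iter X j j' B : pull j (B : set W) (iter j' S X) <-> pull (j' + j)%N B X.
  have e : slide j (z (iter j' S X)) = slide (j' + j)%N (z X).
    by apply: funext => i; rewrite /slide z_iter addnA.
  by rewrite /pull /= e.
have E_N X j : ~ V1 X -> (E (iter j S X) <-> N j X).
  move=> nV1; split=> [[[_ /N_iter //]|[i _ [i' _ [_ [[w wE _] _]]]]]|Nj].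
    case: nV1; apply: (V1_iter X j); exists 0%N => // k _ _.
    by have := @vec_bad _ _ w k; rewrite wE.
  by left; split; [move/V1_iter|apply/N_iter].
have E_rk X j (w w' : W) : V1 X -> val w = slide j (z X) -> val w' = slide j.+1 (z X) ->
    E (iter j S X) <-> (rk (c w) < rk (c w'))%N.
  move=> V1X wE wE'; split=> [[[]|]|ww'].
  - by have := iter_V1 _ j V1X.
  - move=> [i _ [i' _ [ii' [/pull_iter + /pull_iter]]]]; rewrite addn0 addn1.
    move=> [v vE vi] [v' vE' vi'].
    by rewrite (_ : w = v) 1?(_ : w' = v') ?vi ?vi' //; apply: val_inj; rewrite ?wE' ?wE.
  right; exists (rk (c w)) => //; exists (rk (c w')) => //; split=> //.
  split; apply/pull_iter; rewrite ?addn0 ?addn1; first by exists w.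
  by exists w'.
(* Three successive steps between ranks below 3 cannot all go up nor all go
   down, so that E is met and left infinitely often. *)
have V1_ranks X : V1 X -> exists m, exists a : nat -> nat, forall j,
    [/\ (a j < 3)%N, a j <> a j.+1 & E (iter (m + j)%N S X) <-> (a j < a j.+1)%N].
  move=> V1X; have [m _ hm] := V1X; exists m.
  have /choice[w wE] : forall j, exists w : W, val w = slide (m + j)%N (z X).
    move=> j; apply: (@vec_exists Q leQ (slide (m + j)%N (z X))) => k.
    by rewrite /slide addnS -addnA; exact: (hm (m + (j + k))%N I (leq_addr _ _)).
  exists (fun j => rk (c (w j))) => j; split=> //; last first.
    by apply: E_rk => //; rewrite wE addnS.
  move=> /rk_inj; apply: cadj; split.
    move=> ww; have := @vec_bad _ _ (w j) 0%N; apply.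
    have -> : val (w j) 1%N = val (w j.+1) 0%N by rewrite !wE /slide addn1 addn0 addnS.
    by rewrite -ww.
  by left; rewrite !wE; apply: funext => i; rewrite /Defs.shift /slide addnS addnS addSn.
have E_hit X : exists j, E (iter j S X).
  have [V1X|nV1] := pselect (V1 X); last first.
    by have [k _ Nk] := z_bad X 0%N; exists k; apply/(E_N _ _ nV1).
  have [m [a aP]] := V1_ranks X V1X; apply: contrapT => /forallNP nE.
  have dec j : (a j.+1 < a j)%N.
    have [_ ne e] := aP j; have [//|lt|/esym //] := ltngtP (a j.+1) (a j).
    by case: (nE (m + j)%N); apply/e.
  by have [a3 _ _] := aP 0%N; move: a3 (dec 0%N) (dec 1%N) (dec 2%N); clear; lia.
have E_miss X : exists j, ~ E (iter j S X).
  apply: contrapT => /forallNP h.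
  have {}h j : E (iter j S X) by apply: contrapT; exact: h.
  have [V1X|nV1] := pselect (V1 X); last first.
    by apply: (nV1); exists 0%N => // k _ _; apply/(E_N _ _ nV1).
  have [m [a aP]] := V1_ranks X V1X.
  have inc j : (a j < a j.+1)%N by have [_ _ e] := aP j; apply/e.
  by have [a3 _ _] := aP 3%N; move: a3 (inc 0%N) (inc 1%N) (inc 2%N); clear; lia.
have [col bcol colP] := three_colouring Sb bE E_hit E_miss.
apply/borel_chromatic_leP; exists (discrete_topology 'I_3); split.
  split; first by apply: polish_discrete; exact: countableP.
  exists col; split=> // X X' [_ [XX'|X'X]].
    by rewrite (_ : X' = S X) //; apply: val_inj; rewrite SE XX'.
  by rewrite (_ : X = S X'); [exact/nesym|apply: val_inj; rewrite SE X'X].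
by have /card_eqPle[_] := @card_II 3.
Qed.

End Colouring.

(** * Better quasi-orders, and the theorem *)
(** The map B |-> z B 0 is Borel, being a limit of locally constant maps; a set
on which it is increasing along tails contradicts the badness of z. *)
Lemma bqo_transfer (D Q : Type) (leD : D -> D -> Prop) (leQ : Q -> Q -> Prop) q :
  Relation_Definitions.preorder D leD -> limit_reduction leQ leD q ->
  bqo leQ -> bqo leD.
Proof.
move=> leD_pre qP [_ leQ_bqo]; split=> // f bf.
have {}bf (P : set D) : borel (f @^-1` P).
  by apply: bf; apply: borel_open; exact: discrete_open.
have [A [iA fA]] := borel_locally_constant bf.
have tail_box A' B : box [::] A' B -> box [::] A' (tail B).
  by move=> [_ BA]; split=> // i _; exact: (BA i.+1).
pose bad (B : infsubsets) := ~ leD (f B) (f (tail B)).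
(* [bad] itself need not be Borel; [O] is open and agrees with it on the subsets
   of A, where f is locally constant. *)
pose O : set infsubsets := [set B | exists n, forall C : infsubsets, box [::] A C ->
  agree n (val B) (val C) -> bad C].
have oO : prefix_open O.
  move=> B [n hn]; exists n => C BC; exists n => C' AC' CC'.
  by apply: hn => // i i_n; rewrite BC // CC'.
have bad_O B : box [::] A B -> bad B -> O B.
  move=> AB bB; have [n hn] := fA _ AB; have [n' hn'] := fA _ (tail_box _ _ AB).
  exists (maxn n n'.+1) => C AC BC; rewrite /bad (hn C) ?(hn' (tail C)) //.
  - exact: tail_box.
  - by move=> i i_n; apply: BC; rewrite leq_max ltnS i_n orbT.
  - by move=> i i_n; apply: BC; rewrite leq_max i_n.
have [A2 [A21 iA2 dA2]] := ramsey_open oO [::] iA.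
have [B0 [_ B0A]] := infsubset_of_unbounded iA2.
case: dA2 => hO; last first.
  exists B0 => B BB0; apply: contrapT => bB.
  have tB : box [::] A2 B.
    split=> // i _; have [j _ <-] : range (val B0) (val B i) by apply: BB0; exists i.
    exact: B0A.
  by apply: (hO _ tB); apply: bad_O bB; exact: box_sub tB.
exfalso.
have /choice[iota iotaE] : forall B : infsubsets, exists C : infsubsets,
    val C = (fun i => val B0 (val B i)).
  by move=> B; apply: infsubset_exists => k; do 2 apply: infsubsets_lt.
have iota_box B : box [::] A2 (iota B).
  by split=> // i _; rewrite iotaE; exact: B0A.
have iota_tail B : tail (iota B) = iota (tail B).
  by apply: val_inj; rewrite iotaE /= iotaE.
pose X (B : infsubsets) (i : nat) := f (iota (iter i tail B)).
have X_bad B : bad_sequence leD (X B).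
  move=> k; rewrite /X iterS -iota_tail.
  have [n] := hO _ (iota_box (iter k tail B)); apply=> //.
  exact: box_sub (iota_box _).
have /choice[z zP] := fun B => qP.2 _ (X_bad B).
have z_tail B k : z (tail B) k = z B k.+1.
  have [[t ht] [t' ht']] := ((zP (tail B)).1 k, (zP B).1 k.+1).
  rewrite -(ht (maxn t t')) ?leq_maxl // -(ht' (maxn t t')) ?leq_maxr //.
  by congr (q _ _); apply: funext => i; rewrite /slide /X addSn iterSr.
have z_iter B k : z (iter k tail B) 0%N = z B k.
  elim: k B => // k IH B; by rewrite iterSr IH z_tail.
have X_cont B m : exists n, forall C : infsubsets, agree n (val B) (val C) ->
    forall i, (i < m)%N -> X C i = X B i.
  elim: m => [|m [n hn]]; first by exists 0%N.
  have [n' hn'] := fA _ (box_sub A21 (iota_box (iter m tail B))).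
  exists (maxn n (m + n')) => C BC i; rewrite ltnS leq_eqVlt => /orP[/eqP ->|im]; last first.
    by apply: hn im => j jn; apply: BC; rewrite leq_max jn.
  apply: hn'; first exact: box_sub (iota_box _).
  move=> j jn'; rewrite !iotaE; congr (val B0 _).
  have iterE (B' : infsubsets) : val (iter m tail B') j = val B' (m + j)%N.
    by elim: m {hn BC} B' => // m' IH B'; rewrite iterSr IH /= addSn.
  by rewrite !iterE BC // leq_max ltn_add2l jn' orbT.
have [|A3 hA3] := leQ_bqo (fun B => z B 0%N).
  move=> P _; apply: (@borel_limit infsubsets Q (fun t B => q t (slide 0 (X B)))
    (z^~ 0%N) _ _ P).
    by move=> B; exact: (zP B).1.
  move=> t P'; apply: borel_open; apply/open_infsubsetsP => B /= PB.
  have [n hn] := X_cont B t.+2; exists n => C BC.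
  by rewrite (qP.1 t _ (slide 0 (X B))) // => i it; exact: hn.
have [k _] := (zP A3).2 0%N; apply; rewrite -(z_iter _ k) -(z_iter _ k.+1).
apply: (hA3 (iter k tail A3)).
elim: k => // k; apply: subset_trans => _ [j _ <-]; by exists j.+1.
Qed.

Lemma ltree_le1_preorder (Q : Type) (leQ : Q -> Q -> Prop) :
  Relation_Definitions.preorder Q leQ ->
  Relation_Definitions.preorder (labeled_tree Q) (@ltree_le1 Q leQ).
Proof.
move=> [leQ_refl leQ_trans]; split=> [T|T1 T2 T3 [f [f_lt f_le]] [g [g_lt g_le]]].
  by exists id; split.
exists (g \o f); split=> [x y xy|x]; first exact/g_lt/f_lt.
exact: leQ_trans (g_le _).
Qed.

Theorem theorem3p9 (Q : Type) (leQ : Q -> Q -> Prop)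
    (Q_countable : countable [set: Q]) (Q_bqo : bqo leQ) :
  countable_thin leQ -> thin (@ltree_le1 Q leQ).
Proof.
move=> Q_thin; have [leQ_pre _] := Q_bqo; have [leQ_refl _] := leQ_pre.
have [q [q_agree q_lim]] := tree_limit_reduction leQ.
split; first exact: bqo_transfer (ltree_le1_preorder leQ_pre) (conj q_agree q_lim) Q_bqo.
move=> A _.
apply: (@countable_thin_transfer _ _ _ leQ (fun t X => q t (val \o X))) => //.
split=> [t X X' XX'|X bX]; last exact: (q_lim (val \o X) bX).
by apply: q_agree => i it; rewrite /= XX'.
Qed.
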